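(* Let $\varphi\in\mathcal S(V(\mathbb R)^n)$ be in the polynomial Fock space and suppose that its partial Fourier transform $\mathcal F_0\varphi$ is in the ideal $I$. Then $$\theta(t,b)=\sum_{X\in h+L^n}\varphi\big(a(t)^{-1}n(b)^{-1}X\big)$$ is exponentially decreasing (as $t\to\infty$) on the Siegel set $\mathfrak S'$.
   Context: $V$ is a $\mathbb Q$-vector space of dimension $m=p+1$ with a non-degenerate symmetric bilinear form of signature $(p,1)$; $u_0,u_0'\in V$ are isotropic with $(u_0,u_0')=-\frac12$, $\ell_0=\mathbb Qu_0$, $\ell_0'=\mathbb Qu_0'$, $W=\{u_0,u_0'\}^\perp$ (positive definite). $L\subset V$ is a $\mathbb Z$-lattice with $L\subset L^{\#}$, assumed to be of the form $L=(L\cap\ell_0)+(L\cap W)+(L\cap\ell_0')$; $1\le n\le p$, $h\in(L^{\#})^n$. Write $X\in V(\mathbb R)^n$ as $X=(y_1,w,y_m)$ with $y_1=(y_{11},\dots,y_{1n})\in\mathbb R^n$ the $u_0$-coordinates, $w\in W(\mathbb R)^n$, $y_m=(y_{m1},\dots,y_{mn})\in\mathbb R^n$ the $u_0'$-coordinates. The polynomial Fock space is the space of Schwartz functions $P(X)\varphi_0(X)$ with $P$ a polynomial and $\varphi_0(X)=\exp\big(-\pi\sum_j(\frac12y_{1j}^2+(w_j,w_j)+\frac12y_{mj}^2)\big)$. $\mathcal F_0$ is the Fourier transform in the variable $y_1$ (dual variable $\xi\in\mathbb R^n$), leaving $w,y_m$ unchanged. $I$ is the ideal of functions (polynomial times Gaussian)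 in $(\xi,w,y_m)$ that vanish on the linear subspace $\{\xi=0,\ y_m=0\}\cong W(\mathbb R)^n$. $a(t)$, $t>0$, is the isometry $u_0\mapsto tu_0$, $u_0'\mapsto t^{-1}u_0'$, identity on $W$; $n(b)$, $b\in W(\mathbb R)$, is the isometry $u_0\mapsto u_0$, $x\mapsto x+2(x,b)u_0$ for $x\in W$, $u_0'\mapsto u_0'+b+(b,b)u_0$. $\mathfrak S'$ is the set of $n(b)a(t)(u_0+u_0')$ with $b$ in a fixed relatively compact open set and $t>t_0$ for a fixed $t_0>0$; exponentially decreasing on it means bounded by $C_1e^{-C_2t}$ for some constants $C_1,C_2>0$. *)

(* Defs.v *)
From HB Require Import structures.
From mathcomp Require Import all_boot all_order all_algebra.
From mathcomp Require Import complex.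
From mathcomp Require mpoly.
From mathcomp Require Import all_classical all_reals all_analysis.

Set Implicit Arguments.
Unset Strict Implicit.
Unset Printing Implicit Defensive.
Import Order.TTheory GRing.Theory Num.Theory.
Import numFieldNormedType.Exports.

#[global] Open Scope classical_set_scope.
#[global] Open Scope ring_scope.
#[global] Open Scope complex_scope.

Definition has_signature (V : vectType rat) (B : V -> V -> rat) (p q : nat) :=
  exists e : (p + q).-tuple V,
    [/\ basis_of {:V} e,
        (forall i j : 'I_(p + q), i != j -> B e`_i e`_j = 0),
        (forall i : 'I_(p + q), (i < p)%N -> 0 < B e`_i e`_i) &
        (forall i : 'I_(p + q), (p <= i)%N -> B e`_i e`_i < 0)].

Definition is_lattice (V : vectType rat) (L : set V) :=
  exists e : (\dim {:V}).-tuple V,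
    basis_of {:V} e /\ L = [set x | inIntSpan e x].

Definition dual_lattice (V : vectType rat) (B : V -> V -> rat) (L : set V) :
    set V :=
  [set x | forall y, L y -> B x y \is a Num.int].

Definition perp2 (V : vectType rat) (B : {symmetric V}) (u u' : V) :
    {vspace V} :=
  orthov B <<[:: u; u']>>%VS.

Definition lattice_splits (V : vectType rat) (B : {symmetric V}) (u u' : V)
    (L : set V) :=
  L = [set x | exists a b c,
        [/\ L a /\ a \in <[u]>%VS, L b /\ b \in perp2 B u u',
            L c /\ c \in <[u']>%VS & x = a + b + c]].

Definition lattice_coset (V : vectType rat) (n : nat)
    (h : {ffun 'I_n -> V}) (L : set V) : set {ffun 'I_n -> V} :=
  [set X | forall j, L (X j - h j)].

(* Unconditional sum over a set, meaningful when [f] is summable on [D]. *)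
Definition rsum (R : realType) (T : choiceType) (D : set T) (f : T -> R) : R :=
  fine (\esum_(x in D) (f^\+ x)%:E) - fine (\esum_(x in D) (f^\- x)%:E).

Definition csum (R : realType) (T : choiceType) (D : set T) (f : T -> R[i]) :
    R[i] :=
  rsum D (fun x => complex.Re (f x)) +i* rsum D (fun x => complex.Im (f x)).

Definition csummable (R : realType) (T : choiceType) (D : set T)
    (f : T -> R[i]) :=
  summable D (fun x => (complex.Re `|f x|)%:E).

(* Integral over R^n, as an iterated Lebesgue integral (the same number, by
   Fubini, for the rapidly decreasing functions it is applied to). *)
Fixpoint Rn_integral (R : realType) (n : nat) : ('rV[R]_n -> R) -> R :=
  match n with
  | 0 => fun f => f 0
  | n'.+1 => fun f =>
      \int[lebesgue_measure]_x Rn_integral (fun y => f (row_mx x%:M y))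
  end.

Definition Cn_integral (R : realType) (n : nat) (f : 'rV[R]_n -> R[i]) : R[i] :=
  Rn_integral (fun y => complex.Re (f y))
    +i* Rn_integral (fun y => complex.Im (f y)).

Definition cis (R : realType) (x : R) : R[i] := cos x +i* sin x.

(* V(R) is R^(dim V), in coordinates with respect to the Q-basis
   [vbasis {:V}] of V; V(R)^n is the space of n x (dim V) matrices, whose rows
   are the n components. *)
Notation realpts R V := 'rV[R]_(\dim {:V}).
Notation realpts_pow R V n := 'M[R]_(n, \dim {:V}).

Section RealPoints.
Context (R : realType) (V : vectType rat).

Definition to_real (v : V) : realpts R V :=
  \row_i ratr (coord (vbasis {:V}) i v).

Definition to_real_pow n (X : {ffun 'I_n -> V}) : realpts_pow R V n :=
  \matrix_j to_real (X j).

Definition gramR (B : V -> V -> rat) : 'M[R]_(\dim {:V}) :=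
  \matrix_(i, j) ratr (B (vbasis {:V})`_i (vbasis {:V})`_j).

Definition formR (B : V -> V -> rat) (x y : realpts R V) : R :=
  (x *m gramR B *m y^T) 0 0.

Definition is_polynomial n (P : realpts_pow R V n -> R[i]) :=
  exists p : mpoly.mpoly (n * \dim {:V}) R[i],
    forall X, P X = mpoly.meval (fun k => (mxvec X 0 k)%:C) p.

(* From here on u, u' are isotropic with B u u' = -1/2.  Hence
   x = y1coord x *: u + wpart x + ymcoord x *: u' with wpart x orthogonal to u
   and u'. *)
Context (B : V -> V -> rat) (u u' : V).

Local Notation uR := (to_real u).
Local Notation uR' := (to_real u').

Definition y1coord (x : realpts R V) : R := - 2 * formR B x uR'.
Definition ymcoord (x : realpts R V) : R := - 2 * formR B x uR.
Definition wpart (x : realpts R V) : realpts R V :=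
  x - y1coord x *: uR - ymcoord x *: uR'.

Definition Wreal : set (realpts R V) :=
  [set x | formR B x uR = 0 /\ formR B x uR' = 0].

Definition gaussian (c : R) n (X : realpts_pow R V n) : R :=
  expR (- pi * \sum_(j < n)
    (c * y1coord (row j X) ^+ 2 + formR B (wpart (row j X)) (wpart (row j X))
     + 2^-1 * ymcoord (row j X) ^+ 2)).

Definition phi0 n : realpts_pow R V n -> R := gaussian 2^-1 (n := n).

Definition fock_space n : set (realpts_pow R V n -> R[i]) :=
  [set phi | exists2 P, is_polynomial P &
                        forall X, phi X = P X * (phi0 X)%:C].

(* A triple (xi, w, y_m) is encoded as the element
   xi *: u + w + y_m *: u' of V(R)^n. *)
Definition fourier0 n (phi : realpts_pow R V n -> R[i])
    (Y : realpts_pow R V n) : R[i] :=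
  Cn_integral (fun y : 'rV[R]_n =>
    phi (\matrix_j (y 0 j *: uR + wpart (row j Y) + ymcoord (row j Y) *: uR'))
    * cis (- (2 * pi * \sum_(j < n) y1coord (row j Y) * y 0 j))).

(* The partial Fourier transform turns exp (- pi * y^2 / 2) into a multiple of
   exp (- 2 * pi * xi^2). *)
Definition vanishing_ideal n : set (realpts_pow R V n -> R[i]) :=
  [set g | (exists2 P, is_polynomial P &
                       forall Y, g Y = P Y * (gaussian 2 Y)%:C) /\
           (forall Y, (forall j, y1coord (row j Y) = 0 /\
                                 ymcoord (row j Y) = 0) -> g Y = 0)].

Definition a_isom (t : R) (x : realpts R V) : realpts R V :=
  (t * y1coord x) *: uR + wpart x + (t^-1 * ymcoord x) *: uR'.

Definition n_isom (b x : realpts R V) : realpts R V :=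
  y1coord x *: uR + (wpart x + (2 * formR B (wpart x) b) *: uR)
  + ymcoord x *: (uR' + b + formR B b b *: uR).

(* Matrices act on row vectors, hence on V(R)^n, on the right. *)
Definition a_mx (t : R) : 'M[R]_(\dim {:V}) := lin1_mx (a_isom t).
Definition n_mx (b : realpts R V) : 'M[R]_(\dim {:V}) := lin1_mx (n_isom b).

Definition theta_term n (phi : realpts_pow R V n -> R[i]) (t : R)
    (b : realpts R V) (X : {ffun 'I_n -> V}) : R[i] :=
  phi (to_real_pow X *m invmx (n_mx b) *m invmx (a_mx t)).

Definition theta n (phi : realpts_pow R V n -> R[i]) (h : {ffun 'I_n -> V})
    (L : set V) (t : R) (b : realpts R V) : R[i] :=
  csum (lattice_coset h L) (theta_term phi t b).

Definition rel_compact_open_in_W (Omega : set (realpts R V)) :=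
  (exists2 U : set (realpts R V), open U & Omega = U `&` Wreal) /\
  compact (closure Omega).

Definition siegel_set (Omega : set (realpts R V)) (t0 : R) :
    set (realpts R V) :=
  [set n_isom z.2 (a_isom z.1 (uR + uR')) |
     z in [set z : R * realpts R V | t0 < z.1 /\ Omega z.2]].

(* (t, b) are the coordinates of the point n(b) a(t) (u + u'). *)
Definition exp_decreasing_on (S : set (realpts R V))
    (f : R -> realpts R V -> R[i]) :=
  exists C1 C2 : R, [/\ 0 < C1, 0 < C2 &
    forall t b, 0 < t -> Wreal b -> S (n_isom b (a_isom t (uR + uR'))) ->
      `|f t b| <= (C1 * expR (- C2 * t))%:C].

End RealPoints.

(* Main.v *)
(** The sum is split into fibres on which only the [y_1]-coordinates vary.  Such
   a fibre is a translate of [alpha Z^n], and after applying [a(t)^-1] it becomes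
   a grid of mesh [alpha / t] on which a polynomial times a Gaussian is summed.
   If [y_m <> 0], then [y_m] lies outside a fixed neighbourhood of [0] by
   integrality, and [exp (- pi t^2 y_m^2 / 2)] makes the fibre negligible.  If
   [y_m = 0], expand the function in the derivatives [g^(j)] of the Gaussian
   [g].  The coefficient of [g] is, up to a constant, the integral over [y_1],
   which is the value of [F_0 phi] at [xi = 0, y_m = 0] and thus vanishes.  For
   [j >= 1] the sum [S_j] of [g^(j)] over a translate of the grid is periodic as
   a function of the translation and is a derivative, so it vanishes somewhere;
   hence [sup |S_j| <= (alpha / t) sup |S_(j+1)|].  Iterating this about [c t]
   times and using [|g^(m)| <= C m! / (1 + x^2)] shows that [S_j] is
   exponentially small in [t]; this replaces Poisson summation. *)

(* The obstacle is uniformity. The estimates must not depend on the translation of the grid, which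
   varies with [b] and with the fibre, and may depend on (w, y_m) only in a summable way.
   Coefficients of the polynomial in y_1 are therefore treated as functions growing more slowly than
   every exp (d E), where pi E is the part of the Gaussian exponent not involving y_1. The factor
   exp (- pi E) is then shared out: one half absorbs these coefficients, one quarter makes the sum
   over the fibres converge, and one quarter gives the decay in t when y_m is nonzero.

   The number of iterations balances two effects: m derivatives gain (alpha / t)^m and cost m!, the
   growth typical of derivatives of an analytic function. The product is smallest for m of order t,
   where it is exponentially small.

   Sums along a fibre are taken over finite boxes of indices from -M to M. Such a sum can be
   differentiated term by term at once, and a shift by one period is exact up to two boundary terms;
   these account for the slack e that accompanies the bounds and disappears as M grows. *)
Require Import Defs.
From HB Require Import structures.
From mathcomp Require Import all_boot all_order all_algebra.
From mathcomp Require Import complex.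
From mathcomp Require Import all_classical all_reals all_analysis.
From mathcomp Require Import measurable_realfun.
From mathcomp Require mpoly.
From mathcomp Require Import ring lra zify.

Set Implicit Arguments.
Unset Strict Implicit.
Unset Printing Implicit Defensive.
Import Order.TTheory GRing.Theory Num.Theory.
Import numFieldNormedType.Exports.
Local Open Scope ring_scope.

(** * Derivatives of the Gaussian *)

Section GaussianDerivatives.
Context (R : realType) (a : R).
Hypothesis a_gt0 : 0 < a.

(* The derivatives of order [m] and [m.+1] of [exp (- a x^2)], from the Hermite
   three-term recurrence. *)
Fixpoint gauss_pair (m : nat) (x : R) : R * R :=
  if m is m'.+1 then
    let pq := gauss_pair m' x in
    (pq.2, - (2 * a) * (x * pq.2 + m'.+1%:R * pq.1))
  else (expR (- (a * x ^+ 2)), - (2 * a) * (x * expR (- (a * x ^+ 2)))).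

Definition gaussd (m : nat) (x : R) : R := (gauss_pair m x).1.

Lemma gaussd0 x : gaussd 0 x = expR (- (a * x ^+ 2)).
Proof. by []. Qed.

Lemma gaussd1 x : gaussd 1 x = - (2 * a) * (x * gaussd 0 x).
Proof. by []. Qed.

Lemma gaussdSS m x :
  gaussd m.+2 x = - (2 * a) * (x * gaussd m.+1 x + m.+1%:R * gaussd m x).
Proof. by []. Qed.

Lemma is_derive_gaussd m (x : R) : is_derive x (1 : R) (gaussd m) (gaussd m.+1 x).
Proof.
elim/ltn_ind: m x => -[|[|m]] IH x.
- rewrite (_ : gaussd 0 = expR \o (fun x => - (a * x ^+ 2))); last exact/funext.
  apply: is_derive_eq; rewrite gaussd1 gaussd0 /GRing.scale/=; ring.
- have d0 := IH 0%N (ltnSn _) x.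
  rewrite (_ : gaussd 1 = (fun x => - (2 * a) * (x * gaussd 0 x))); last exact/funext.
  apply: is_derive_eq; rewrite [RHS]gaussdSS !gaussd1 /GRing.scale/=; ring.
- have d0 := IH m (leqnSn _) x.
  have d1 := IH m.+1 (ltnSn _) x.
  rewrite (_ : gaussd m.+2 = (fun x => - (2 * a) * (x * gaussd m.+1 x + m.+1%:R * gaussd m x))); last exact/funext.
  apply: is_derive_eq. rewrite [RHS]gaussdSS /GRing.scale/= -[m.+2%:R]natr1; ring.
Qed.

(** The recurrence solved for the product with x. Iterating it expands x^k g in the derivatives of
    g. *)
Lemma mulx_gaussd m x :
  x * gaussd m.+1 x = - (2 * a)^-1 * gaussd m.+2 x - m.+1%:R * gaussd m x.
Proof. by rewrite gaussdSS; field; rewrite gt_eqF. Qed.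

Lemma mulx_gaussd0 x : x * gaussd 0 x = - (2 * a)^-1 * gaussd 1 x.
Proof. by rewrite gaussd1; field; rewrite gt_eqF. Qed.

(** The exponential series is truncated so that a factor y can be traded for a factor m + 1
    ([texpS]); the full exponential does not allow this. *)
Let texp m (y : R) := \sum_(r < m.+1) y ^+ r / r`!%:R.

Lemma expR_partial_sum m (y : R) : 0 <= y -> texp m y <= expR y.
Proof.
move=> y0; rewrite /texp /expR.
have -> : \sum_(r < m.+1) y ^+ r / r`!%:R = series (exp_coeff y) m.+1.
  by rewrite /series/= big_mkord.
apply: nondecreasing_cvgn_le; last exact: is_cvg_series_exp_coeff.
apply/nondecreasing_seqP => k; rewrite /series/= big_nat_recr//= lerDl.
by rewrite /exp_coeff/= divr_ge0// exprn_ge0.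
Qed.

Lemma texp_le m (y : R) : 0 <= y -> texp m y <= texp m.+1 y.
Proof. by move=> y0; rewrite /texp [leRHS]big_ord_recr/= lerDl divr_ge0// exprn_ge0. Qed.

Lemma texpS m (y : R) : 0 <= y -> y * texp m y <= m.+1%:R * texp m.+1 y.
Proof.
move=> y0; rewrite /texp [in leRHS]big_ord_recl/= mulrDr.
rewrite -[leLHS]add0r; apply: lerD; first by rewrite expr0 fact0 divr1 mulr1.
rewrite !mulr_sumr; apply: ler_sum => i _; rewrite /bump/= add1n exprS.
rewrite factS natrM invfM -!mulrA [leRHS]mulrCA ler_wpM2l//.
rewrite mulrCA ler_wpM2l ?exprn_ge0// mulrA ler_peMl ?invr_ge0//.
by rewrite ler_pdivlMr// mul1r ler_nat ltn_ord.
Qed.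

(** Induction along the three-term recurrence. Its two terms, x g^(m+1) and (m+1) g^(m), are bounded
    by |x| and 1 times the same quantity, hence the factor |x| + 1; the remaining factor y is
    absorbed by [texpS]. *)
Lemma gaussd_bound_texp m x :
  `|gaussd m x| <= m`!%:R * texp m (2 * a * (`|x| + 1)) * gaussd 0 x.
Proof.
set y := 2 * a * (`|x| + 1).
have y0 : 0 <= y by rewrite /y !mulr_ge0// ?(ltW a_gt0)// addr_ge0.
have g0 : 0 <= gaussd 0 x by exact: expR_ge0.
have n2 : `|- (2 * a)| = 2 * a by rewrite normrN gtr0_norm ?mulr_gt0.
elim/ltn_ind: m => -[|[|m]] IH.
- rewrite ger0_norm// fact0 /texp big_ord_recl big_ord0 expr0 fact0; lra.
- rewrite gaussd1 (_ : 1`! = 1)%N// !normrM (ger0_norm g0) n2 mulrA ler_wpM2r// mul1r.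
  rewrite /texp !big_ord_recl big_ord0 expr0 /= /bump/= expr1 fact0.
  rewrite (_ : (1 + 0)`!%:R = 1)// /y; have := a_gt0; lra.
- rewrite gaussdSS normrM n2.
  have i1 := IH m.+1 (ltnSn _); have i0 := IH m (leqnSn _).
  apply: (@le_trans _ _ (y * (m.+1`!%:R * texp m.+1 y * gaussd 0 x))).
    rewrite {1}/y -[leRHS]mulrA ler_wpM2l ?mulr_ge0 ?(ltW a_gt0)//.
    rewrite (le_trans (ler_normD _ _))// !normrM mulrDl mul1r lerD//.
      by rewrite ler_wpM2l.
    rewrite ger0_norm// factS natrM -!mulrA ler_wpM2l// (le_trans i0)//.
    by rewrite -mulrA ler_wpM2l// ler_wpM2r// texp_le.
  rewrite mulrA ler_wpM2r// mulrCA [m.+2`!]factS mulnC natrM -[leRHS]mulrA.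
  by rewrite ler_wpM2l// texpS.
Qed.

(** The first factor comes from completing the square, 2a(|x| + 1) - a x^2 = 4a - (a/2) x^2 -
    (a/2)(|x| - 2)^2, and the second from 1 + x^2 <= (1 + 2/a)(1 + (a/2) x^2). *)
Definition gauss_cst : R := expR (4 * a) * (1 + 2 / a).

Lemma gauss_cst_gt0 : 0 < gauss_cst.
Proof. by rewrite mulr_gt0 ?expR_gt0// addr_gt0// divr_gt0. Qed.

Lemma gaussd_bound m x :
  `|gaussd m x| <= m`!%:R * (gauss_cst * (1 + x ^+ 2)^-1).
Proof.
apply: (le_trans (gaussd_bound_texp m x)); rewrite -mulrA ler_wpM2l//.
have y0 : 0 <= 2 * a * (`|x| + 1) by rewrite !mulr_ge0// ?(ltW a_gt0)// addr_ge0.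
apply: (@le_trans _ _ (expR (2 * a * (`|x| + 1)) * gaussd 0 x)).
  by rewrite ler_wpM2r ?expR_ge0// expR_partial_sum.
rewrite gaussd0 -expRD.
apply: (@le_trans _ _ (expR (4 * a - (a / 2) * x ^+ 2))).
  rewrite ler_expR -(real_normK (num_real x)) -subr_ge0.
  rewrite (_ : _ - _ = (a / 2) * (`|x| - 2) ^+ 2); last by field.
  by rewrite mulr_ge0 ?sqr_ge0// divr_ge0// ltW.
rewrite expRD /gauss_cst -[leRHS]mulrA ler_wpM2l ?expR_ge0// expRN.
rewrite ler_pdivlMr ?ltr_wpDr ?sqr_ge0// mulrC ler_pdivrMr ?expR_gt0//.
apply: (@le_trans _ _ ((1 + 2 / a) * (1 + a / 2 * x ^+ 2))); last first.
  by rewrite ler_wpM2l ?expR_ge1Dx// addr_ge0// divr_ge0// ltW.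
have -> : (1 + 2 / a) * (1 + a / 2 * x ^+ 2) =
   1 + x ^+ 2 + 2 / a + a / 2 * x ^+ 2 by field; rewrite gt_eqF.
have h1 : 0 <= 2 / a by rewrite divr_ge0// ltW.
have h2 : 0 <= a / 2 * x ^+ 2 by rewrite mulr_ge0 ?sqr_ge0// divr_ge0// ltW.
lra.
Qed.

End GaussianDerivatives.

(** * Sums over grids of the line *)

Section BoxSums.
Context (R : realType).

Lemma derivable_continuous_within (f df : R -> R) (A : set R) :
  (forall x, is_derive x (1 : R) f (df x)) -> {within A, continuous f}.
Proof.
move=> fdf; apply: continuous_subspaceT => x.
apply/differentiable_continuous/derivable1_diffP.
exact: (@ex_derive _ _ _ _ _ _ _ (fdf x)).
Qed.

(* The bound telescopes along a grid of mesh [d]. *)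
Lemma lorentz_step (x d d0 : R) : 0 < d -> d <= d0 ->
  (1 + x ^+ 2)^-1 <= (2 + 2 * d0 ^+ 2) / d * (atan (x + d) - atan x).
Proof.
move=> d_gt0 dd0.
have [| |y] := @MVT R atan (fun y => (1 + y ^+ 2)^-1) x (x + d).
- by rewrite ltrDl.
- by apply: derivable_continuous_within => y; exact: is_derive1_atan.
rewrite in_itv/= => /andP[xy yxd] ->.
rewrite (_ : x + d - x = d); last by ring.
have pos (z : R) : 0 < 1 + z ^+ 2 by rewrite ltr_wpDr ?sqr_ge0.
rewrite [X in _ <= _ * X]mulrC mulrA divfK ?gt_eqF//.
rewrite ler_pdivlMr// mulrC ler_pdivrMr//.
have : (y - x) ^+ 2 <= d0 ^+ 2.
  by rewrite ler_sqr ?nnegrE; lra.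
have := sqr_ge0 (y - 2 * x); have := sqr_ge0 d0; have := sqr_ge0 x.
nra.
Qed.

Lemma lorentz_sum (d0 : R) : 0 < d0 -> exists2 C : R, 0 < C &
  forall (d x : R) N, 0 < d -> d <= d0 ->
  \sum_(i < N) (1 + (x + i%:R * d) ^+ 2)^-1 <= C / d.
Proof.
move=> d0_gt0; exists ((2 + 2 * d0 ^+ 2) * pi).
  by rewrite mulr_gt0 ?pi_gt0// ltr_pwDl// mulr_ge0 ?sqr_ge0.
move=> d x N d_gt0 dd0.
apply: (@le_trans _ _ ((2 + 2 * d0 ^+ 2) / d *
    (atan (x + N%:R * d) - atan x))).
  elim: N => [|N IH]; first by rewrite big_ord0 mul0r addr0 subrr mulr0.
  rewrite big_ord_recr/=; apply: (le_trans (lerD IH (lorentz_step _ d_gt0 dd0))).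
  rewrite (_ : x + N.+1%:R * d = x + N%:R * d + d); last by rewrite -[N.+1%:R]natr1; ring.
  by rewrite -mulrDr le_eqVlt; apply/orP; left; apply/eqP; congr (_ * _); ring.
rewrite [leRHS]mulrAC; apply: ler_wpM2l.
  by rewrite divr_ge0 ?(ltW d_gt0)// addr_ge0// mulr_ge0 ?sqr_ge0.
have := atan_gtNpi2 x; have := atan_ltpi2 (x + N%:R * d); lra.
Qed.

(** Subtracting [M] from the summation index makes it run over the integers from -M to M. *)
Definition box_sum (f : R -> R) (alpha t s : R) (M : nat) : R :=
  \sum_(i < M.*2.+1) f ((alpha * (i%:R - M%:R) + s) / t).

Lemma box_sum_bound (alpha t0 : R) : 0 < alpha -> 0 < t0 ->
  exists2 C : R, 0 < C & forall (f : R -> R) (K : R), 0 <= K ->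
    (forall x, `|f x| <= K * (1 + x ^+ 2)^-1) ->
  forall t s M, t0 < t -> box_sum (fun x => `|f x|) alpha t s M <= K * C * t.
Proof.
move=> al0 t00; have [C C0 HC] := @lorentz_sum (alpha / t0) (divr_gt0 al0 t00).
exists (C / alpha); first exact: divr_gt0.
move=> f K K0 fK t s M tt0; have t_gt0 := lt_trans t00 tt0.
apply: (@le_trans _ _ (K * \sum_(i < M.*2.+1)
    (1 + ((s - alpha * M%:R) / t + i%:R * (alpha / t)) ^+ 2)^-1)).
  rewrite mulr_sumr; apply: ler_sum => i _; apply: (le_trans (fK _)).
  by rewrite (_ : _ / t = (s - alpha * M%:R) / t + i%:R * (alpha / t))//; field; rewrite gt_eqF.
rewrite -mulrA ler_wpM2l//; apply: (le_trans (HC _ _ _ _ _)).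
- exact: divr_gt0.
- by rewrite ler_wpM2l ?(ltW al0)// lef_pV2 ?posrE// ltW.
- by rewrite invf_div mulrA mulrAC.
Qed.

Lemma box_sum_norm f alpha t s M :
  `|box_sum f alpha t s M| <= box_sum (fun x => `|f x|) alpha t s M.
Proof. exact: ler_norm_sum. Qed.

Lemma is_derive_box_sum (f df : R -> R) alpha t M (s : R) : 
  (forall x, is_derive x (1 : R) f (df x)) ->
  is_derive s (1 : R) (fun s => box_sum f alpha t s M)
    (t^-1 * box_sum df alpha t s M).
Proof.
move=> fdf; rewrite /box_sum mulr_sumr.
have h i : is_derive s (1 : R) (fun s => f ((alpha * (i%:R - M%:R) + s) / t))
    (t^-1 * df ((alpha * (i%:R - M%:R) + s) / t)).
  have h : is_derive s (1 : R) (fun s => (alpha * (i%:R - M%:R) + s) / t) t^-1.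
    apply: is_derive_eq; rewrite /GRing.scale/=; ring.
  have hf := fdf ((alpha * (i%:R - M%:R) + s) / t).
  rewrite [t^-1 * _]mulrC.
  exact: (@is_derive1_comp R f (fun s => (alpha * (i%:R - M%:R) + s) / t) s _ _ hf h).
rewrite (_ : (fun s => \sum_(i < M.*2.+1) f ((alpha * (i%:R - M%:R) + s) / t)) =
  \sum_(i < M.*2.+1) (fun s => f ((alpha * ((i : nat)%:R - M%:R) + s) / t))); last first.
  by apply/funext => z; rewrite fct_sumE.
exact: is_derive_sum.
Qed.

Lemma box_sum_shift f alpha t s M :
  box_sum f alpha t (s + alpha) M - box_sum f alpha t s M =
  f ((alpha * M.+1%:R + s) / t) - f ((s - alpha * M%:R) / t).
Proof.
rewrite /box_sum big_ord_recr [in X in _ - X]big_ord_recl/=.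
rewrite (eq_bigr (fun i : 'I_ _ => f ((alpha * ((bump 0 i)%:R - M%:R) + s) / t))).
  have e (x y z : R) : x + y - (z + x) = y - z by ring.
  rewrite e; congr (f _ - f _); congr (_ / t); last by ring.
  by rewrite -addnn natrD -[M.+1%:R]natr1; ring.
by move=> i _; rewrite /bump/= natrD; congr (f _); congr (_ / t); ring.
Qed.

End BoxSums.

(** * Exponential smallness of truncated sums of derivatives *)

Section Decay.
Context (R : realType).

Lemma MVT_bound (f df : R -> R) (a b B u v : R) :
  (forall x, is_derive x (1 : R) f (df x)) ->
  (forall x, a <= x <= b -> `|df x| <= B) ->
  a <= u <= b -> a <= v <= b -> `|f u - f v| <= B * (b - a).
Proof.
move=> fdf dfB.
wlog uv : u v / v <= u.
  move=> H ub vb; have [vu|/ltW uv] := leP v u; first exact: H.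
  by rewrite distrC; apply: H.
move=> /andP[au ub] /andP[av vb].
have B0 : 0 <= B by apply: le_trans (dfB a _) => //; rewrite lexx (le_trans au).
have [|c] := @MVT_segment R f df v u uv (fun x _ => fdf x).
  exact: derivable_continuous_within fdf.
rewrite in_itv/= => /andP[vc cu] ->.
rewrite normrM; apply: ler_pM => //.
  by apply: dfB; rewrite (le_trans av vc) (le_trans cu ub).
by rewrite ger0_norm ?subr_ge0// lerB.
Qed.

Lemma lorentz_tail (f : R -> R) (K e : R) : 0 <= K -> 0 < e ->
  (forall x, `|f x| <= K * (1 + x ^+ 2)^-1) ->
  exists2 X : R, 0 < X & forall x, X <= `|x| -> `|f x| <= e.
Proof.
move=> K0 e0 fK; have Ke0 : 0 <= K / e by rewrite divr_ge0// ltW.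
exists (1 + K / e); first lra.
move=> x Xx; apply: (le_trans (fK x)).
rewrite ler_pdivrMr ?ltr_wpDr ?sqr_ge0// -(real_normK (num_real x)).
have -> : K = e * (K / e) by rewrite mulrCA divff ?gt_eqF// mulr1.
rewrite ler_wpM2l ?(ltW e0)//.
have := normr_ge0 x; nra.
Qed.

(** Each new factor satisfies k + N + 1 <= (k + 1)(N + 1). The power of k + 1 can then be merged
    with the power of the mesh, leaving N! alone. *)
Lemma fact_addn_le k N : ((k + N)`! <= k`! * k.+1 ^ N * N`!)%N.
Proof.
elim: N => [|N IH]; first by rewrite addn0 expn0 fact0 !muln1.
rewrite addnS !factS expnS.
apply: (@leq_trans ((k.+1 * N.+1) * (k`! * k.+1 ^ N * N`!))); last first.
  by apply: eq_leq; ring.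
apply: leq_mul => //; rewrite mulnS mulSn addSn ltnS leq_add2l.
exact: leq_addr.
Qed.

Lemma fact_le_expn k N : (k <= N -> k`! <= N ^ k)%N.
Proof.
elim: k => [|k IH] kN; first by rewrite expn0.
by rewrite factS expnS leq_mul// IH// ltnW.
Qed.

Lemma pow_le_expR k (d : R) : 0 < d ->
  exists2 C : R, 0 < C & forall t : R, 0 <= t -> t ^+ k <= C * expR (d * t).
Proof.
elim: k d => [|k IH] d d0.
  exists 1 => // t t0; rewrite expr0 mul1r.
  by apply: le_trans (expR_ge1Dx _); rewrite lerDl mulr_ge0// ltW.
have d20 : 0 < d / 2 by rewrite divr_gt0.
have [C C0 HC] := IH _ d20.
exists (C * (2 / d)); first by rewrite mulr_gt0// divr_gt0.
move=> t t0; rewrite exprSr.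
apply: (@le_trans _ _ (C * expR (d / 2 * t) * (2 / d * expR (d / 2 * t)))).
  apply: ler_pM => //; rewrite ?exprn_ge0 ?HC//.
  rewrite mulrAC ler_pdivlMr//.
  have := expR_ge1Dx (d / 2 * t); lra.
have -> : expR (d * t) = expR (d / 2 * t) * expR (d / 2 * t).
  by rewrite -expRD; congr expR; lra.
by rewrite le_eqVlt; apply/orP; left; apply/eqP; ring.
Qed.

(** Choice of the number of iterations. For N the integer part of t / (2q), N! <= N^N and q N / t <=
    1/2 <= exp (- 1/2), so the product is at most exp (- N/2). Rounding down costs the factor exp
    (1/2). *)
Lemma pow_fact_le_expR (q t : R) : 0 < q -> 0 < t ->
  exists N, (q / t) ^+ N * N`!%:R <= expR 2^-1 * expR (- ((4 * q)^-1 * t)).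
Proof.
move=> q0 t0; pose N := Num.truncn (t / (2 * q)); exists N.
have tq0 : 0 <= t / (2 * q) by rewrite divr_ge0 ?(ltW t0)// mulr_ge0// ltW.
have /andP[N1 N2] := truncn_itv tq0.
rewrite -/N in N1 N2.
apply: (@le_trans _ _ (expR (- 2^-1) ^+ N)).
  apply: (@le_trans _ _ ((q / t * N%:R) ^+ N)).
    rewrite [leRHS]exprMn ler_wpM2l ?exprn_ge0 ?divr_ge0 ?(ltW q0) ?(ltW t0)//.
    by rewrite -natrX ler_nat fact_le_expn.
  have qtN : 0 <= q / t * N%:R by rewrite !mulr_ge0 ?invr_ge0 ?(ltW q0) ?(ltW t0).
  apply: lerXn2r; rewrite ?nnegrE ?expR_ge0//.
  apply: (@le_trans _ _ (2^-1)); last first.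
    by apply: le_trans (expR_ge1Dx _); lra.
  rewrite mulrAC ler_pdivrMr//; move: N1; rewrite ler_pdivlMr ?mulr_gt0//; lra.
rewrite -expRM_natr -expRD ler_expR.
have -> : (4 * q)^-1 * t = 2^-1 * (t / (2 * q)) by field; rewrite gt_eqF.
rewrite -[N.+1%:R]natr1 in N2; move: N2; set z := t / (2 * q); lra.
Qed.

Context (alpha t0 : R).
Hypotheses (alpha_gt0 : 0 < alpha) (t0_gt0 : 0 < t0).

(* The index [M] is a truncation parameter and [i] a parameter in which the bound
   is uniform; the slack [e] disappears as [M] tends to infinity. *)
Definition exp_small (I : Type) (D : I -> R -> nat -> R) :=
  exists C1 C2 : R, [/\ 0 < C1, 0 < C2 & forall i (t e : R), t0 < t -> 0 < e ->
    exists M0, forall M, (M0 <= M)%N -> `|D i t M| <= e + C1 * expR (- (C2 * t))].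

(** Growth below every exponential rate: multiplying by such a factor costs an [exp_small] quantity
    only part of its rate. *)
Definition subexp (I : Type) (D : I -> R -> nat -> R) :=
  forall d : R, 0 < d -> exists2 C : R, 0 < C &
    forall i t M, t0 < t -> `|D i t M| <= C * expR (d * t).

Lemma exp_small_comp (I J : Type) (h : J -> I) D :
  exp_small D -> exp_small (fun j => D (h j)).
Proof.
by move=> [C1 [C2 [? ? H]]]; exists C1, C2; split => // j; exact: H.
Qed.

Lemma subexp_comp (I J : Type) (h : J -> I) D :
  subexp D -> subexp (fun j => D (h j)).
Proof.
by move=> H d /H[C C0 HC]; exists C => // j; exact: HC.
Qed.

Lemma exp_small_ext (I : Type) (D D' : I -> R -> nat -> R) :
  (forall i t M, D i t M = D' i t M) -> exp_small D -> exp_small D'.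
Proof.
move=> DD' [C1 [C2 [? ? H]]]; exists C1, C2; split => // i t e ht he.
by have [M0 HM] := H i t e ht he; exists M0 => M /HM; rewrite DD'.
Qed.

Lemma exp_small0 (I : Type) : exp_small (fun (_ : I) _ _ => 0).
Proof.
exists 1, 1; split => // i t e _ e0; exists 0%N => M _.
by rewrite normr0 addr_ge0 ?mul1r ?expR_ge0// ltW.
Qed.

Lemma exp_small_add (I : Type) (D D' : I -> R -> nat -> R) :
  exp_small D -> exp_small D' -> exp_small (fun i t M => D i t M + D' i t M).
Proof.
move=> [C1 [C2 [C10 C20 H]]] [C1' [C2' [C10' C20' H']]].
pose c := Num.min C2 C2'.
have cC : c <= C2 by rewrite ge_min lexx.
have cC' : c <= C2' by rewrite ge_min lexx orbT.
exists (C1 + C1'), c; split; [exact: addr_gt0|by rewrite lt_min C20|].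
move=> i t e ht e0; have e20 : 0 < e / 2 by rewrite divr_gt0.
have t_ge0 : 0 <= t by rewrite ltW// (lt_trans t0_gt0).
have [M0 HM] := H i t _ ht e20; have [M0' HM'] := H' i t _ ht e20.
exists (maxn M0 M0') => M; rewrite geq_max => /andP[/HM h /HM' h'].
apply: (le_trans (ler_normD _ _)); apply: (le_trans (lerD h h')).
have l1 : C1 * expR (- (C2 * t)) <= C1 * expR (- (c * t)).
  by rewrite ler_wpM2l ?(ltW C10)// ler_expR lerN2 ler_wpM2r.
have l2 : C1' * expR (- (C2' * t)) <= C1' * expR (- (c * t)).
  by rewrite ler_wpM2l ?(ltW C10')// ler_expR lerN2 ler_wpM2r.
by rewrite mulrDl; lra.
Qed.

Lemma exp_small_mul (I : Type) (D G : I -> R -> nat -> R) :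
  exp_small D -> subexp G -> exp_small (fun i t M => D i t M * G i t M).
Proof.
move=> [C1 [C2 [C10 C20 H]]] HG.
have C220 : 0 < C2 / 2 by rewrite divr_gt0.
have [C C0 HC] := HG _ C220.
exists (C1 * C), (C2 / 2); split => //; first exact: mulr_gt0.
(* The slack must be divided by the size [G0] of the other factor. [G0] depends on [t], which is
   harmless because [M0] may depend on [t] and [e]. *)
move=> i t e ht e0; pose G0 := C * expR (C2 / 2 * t).
have G00 : 0 < G0 by rewrite mulr_gt0 ?expR_gt0.
have [M0 HM] := H i t _ ht (divr_gt0 e0 G00).
exists M0 => M /HM h; rewrite normrM.
apply: (@le_trans _ _ ((e / G0 + C1 * expR (- (C2 * t))) * G0)).
  by apply: ler_pM => //; exact: HC.
rewrite mulrDl divfK ?gt_eqF// lerD2l /G0.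
rewrite mulrACA -expRD le_eqVlt; apply/orP; left; apply/eqP.
by congr (_ * expR _); lra.
Qed.

Lemma subexp_cst (I : Type) (c : R) : subexp (fun (_ : I) _ _ => c).
Proof.
move=> d d0; exists (`|c| + 1); first by rewrite ltr_wpDl.
move=> i t M ht; have t_gt0 := lt_trans t0_gt0 ht.
rewrite -[leLHS]mulr1; apply: ler_pM => //; first by rewrite lerDl.
by apply: le_trans (expR_ge1Dx _); rewrite lerDl mulr_ge0// ltW.
Qed.

Lemma exp_small_scale (I : Type) c (D : I -> R -> nat -> R) :
  exp_small D -> exp_small (fun i t M => c * D i t M).
Proof.
move=> H; apply: exp_small_ext (exp_small_mul H (subexp_cst I c)) => i t M.
by rewrite mulrC.
Qed.

Lemma subexp_mul (I : Type) (D G : I -> R -> nat -> R) :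
  subexp D -> subexp G -> subexp (fun i t M => D i t M * G i t M).
Proof.
move=> HD HG d d0; have d20 : 0 < d / 2 by rewrite divr_gt0.
have [C C0 HC] := HD _ d20; have [C' C0' HC'] := HG _ d20.
exists (C * C'); first exact: mulr_gt0.
move=> i t M ht; rewrite normrM.
apply: (@le_trans _ _ (C * expR (d / 2 * t) * (C' * expR (d / 2 * t)))).
  by apply: ler_pM => //; [exact: HC|exact: HC'].
rewrite mulrACA -expRD le_eqVlt; apply/orP; left; apply/eqP.
by congr (_ * expR _); lra.
Qed.

Lemma subexp_box_sum (f : R -> R) (K : R) : 0 <= K -> (forall x, `|f x| <= K * (1 + x ^+ 2)^-1) ->
  subexp (fun s t M => box_sum f alpha t s M).
Proof.
move=> K0 fK d d0; have [C C0 HC] := box_sum_bound alpha_gt0 t0_gt0.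
have [C' C0' HC'] := @pow_le_expR 1 d d0.
exists (K * C * C' + 1).
  by rewrite ltr_wpDl// !mulr_ge0// ltW.
move=> s t M ht; have t_gt0 := lt_trans t0_gt0 ht.
apply: (le_trans (box_sum_norm _ _ _ _ _)).
apply: (le_trans (HC _ _ K0 fK _ _ _ ht)).
apply: (@le_trans _ _ (K * C * (C' * expR (d * t)))).
  by rewrite ler_wpM2l ?mulr_ge0 ?(ltW C0)//; have := HC' t (ltW t_gt0); rewrite expr1.
by rewrite mulrA ler_wpM2r ?expR_ge0// lerDl.
Qed.

Context (g : nat -> R -> R) (K : R).
Hypotheses (K_gt0 : 0 < K)
  (dg : forall m x, is_derive x (1 : R) (g m) (g m.+1 x))
  (gK : forall m x, `|g m x| <= m`!%:R * (K * (1 + x ^+ 2)^-1)).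

(* Shifting a truncated sum by one period only changes two boundary terms.  So by
   the mean value theorem the sum of the derivatives is almost [0] somewhere in
   each period, and applying the theorem once more bounds it by the sum of the
   next derivatives times [alpha / t]. *)
Lemma box_sum_iter : exists2 C : R, 0 < C &
  forall N m (t s0 e : R), t0 < t -> 0 < e ->
  exists M0, forall M s, (M0 <= M)%N -> s0 <= s <= s0 + alpha ->
    `|box_sum (g m.+1) alpha t s M| <=
      e + (alpha / t) ^+ N * ((m.+1 + N)`!%:R * C * t).
Proof.
have [C C0 HC] := box_sum_bound alpha_gt0 t0_gt0.
exists (K * C); first exact: mulr_gt0.
have fK m : forall x, `|g m x| <= m`!%:R * K * (1 + x ^+ 2)^-1.
  by move=> x; rewrite -mulrA.
have fK0 m : 0 <= m`!%:R * K by rewrite mulr_ge0// ltW.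
elim=> [|N IH] m t s0 e ht e0; have t_gt0 := lt_trans t0_gt0 ht.
  exists 0%N => M s _ _; rewrite expr0 mul1r addn0.
  apply: (le_trans (box_sum_norm _ _ _ _ _)).
  apply: (le_trans (HC _ _ (fK0 _) (fK _) _ _ _ ht)).
  by rewrite !mulrA; lra.
have at0 : 0 < alpha / t by rewrite divr_gt0.
(* One half of the slack passes through the mean value estimate, which multiplies it by alpha / t.
   The two boundary terms share the other half after division by alpha / t. *)
have e10 : 0 < e / 2 / (alpha / t) by rewrite !divr_gt0.
have e20 : 0 < e / 4 * (alpha / t) by rewrite mulr_gt0// divr_gt0.
have [M1 HM1] := IH m.+1 t s0 _ ht e10.
have [X X0 HX] := lorentz_tail (fK0 m) e20 (fK m).
have y0 : 0 <= (X * t + `|s0|) / alpha.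
  by rewrite divr_ge0 ?(ltW alpha_gt0)// addr_ge0// mulr_ge0 ?ltW.
(* From here on both boundary points lie outside [-X, X]. The choice involves [s0] but not [s], so
   the bound holds on the whole period, as needed at the unknown mean value point. *)
pose M2 := Num.bound ((X * t + `|s0|) / alpha).
exists (maxn M1 M2) => M s; rewrite geq_max => /andP[M1M M2M] sI.
have aM : X * t + `|s0| <= alpha * M%:R.
  rewrite [leRHS]mulrC -ler_pdivrMr//.
  by apply: le_trans (ltW (archi_boundP y0)) _; rewrite ler_nat.
have s0a : s0 < s0 + alpha by rewrite ltrDl.
have [|c cI] := @MVT R (fun s => box_sum (g m) alpha t s M)
    (fun s => t^-1 * box_sum (g m.+1) alpha t s M) s0 (s0 + alpha) s0a
    (fun x _ => is_derive_box_sum alpha t M x (dg m)).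
  apply: derivable_continuous_within => x.
  exact: (is_derive_box_sum alpha t M x (dg m)).
rewrite box_sum_shift => Hc.
have Sc : `|box_sum (g m.+1) alpha t c M| <= e / 2.
  have -> : box_sum (g m.+1) alpha t c M = (alpha / t)^-1 *
     (g m ((alpha * M.+1%:R + s0) / t) - g m ((s0 - alpha * M%:R) / t)).
    by rewrite Hc; field; rewrite !gt_eqF.
  rewrite normrM [`|_^-1|]gtr0_norm ?invr_gt0// mulrC ler_pdivrMr//.
  apply: (le_trans (ler_normB _ _)).
  have -> : e / 2 * (alpha / t) = e / 4 * (alpha / t) + e / 4 * (alpha / t).
    by rewrite -mulrDl; congr (_ * _); lra.
  have s1 := ler_norm s0; have s2 := ler_norm (- s0); rewrite normrN in s2.
  apply: lerD; apply: HX; rewrite normrM (gtr0_norm (_ : 0 < t^-1)) ?invr_gt0// ler_pdivlMr//.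
    by apply: le_trans (ler_norm _); rewrite -[M.+1%:R]natr1; lra.
  by rewrite distrC; apply: le_trans (ler_norm _); lra.
have B1 : forall x, s0 <= x <= s0 + alpha ->
   `|t^-1 * box_sum (g m.+2) alpha t x M| <= t^-1 * (e / 2 / (alpha / t) +
      (alpha / t) ^+ N * ((m.+2 + N)`!%:R * (K * C) * t)).
  move=> x xI; rewrite normrM gtr0_norm ?invr_gt0// ler_wpM2l ?invr_ge0 ?(ltW t_gt0)//.
  exact: HM1.
have cI' : s0 <= c <= s0 + alpha.
  by move: cI; rewrite in_itv/= => /andP[/ltW -> /ltW ->].
have := MVT_bound (fun x => is_derive_box_sum alpha t M x (dg m.+1)) B1 sI cI'.
rewrite (_ : s0 + alpha - s0 = alpha); last by ring.
move=> Hd.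
have -> : box_sum (g m.+1) alpha t s M =
  (box_sum (g m.+1) alpha t s M - box_sum (g m.+1) alpha t c M) + box_sum (g m.+1) alpha t c M by rewrite subrK.
apply: (le_trans (ler_normD _ _)); apply: (le_trans (lerD Hd Sc)).
rewrite addnS -addSn exprS le_eqVlt; apply/orP; left; apply/eqP.
by field; rewrite !gt_eqF.
Qed.

Lemma exp_small_box_sum m : exp_small (fun s t M => box_sum (g m.+1) alpha t s M).
Proof.
have [C C0 HC] := box_sum_iter.
(* [fact_addn_le] with k = m + 1 contributes (m + 2)^N, which joins (alpha / t)^N. *)
pose q := m.+2%:R * alpha.
have q0 : 0 < q by rewrite mulr_gt0.
have c0 : 0 < (4 * q)^-1 by rewrite invr_gt0 mulr_gt0.
have c20 : 0 < (4 * q)^-1 / 2 by rewrite divr_gt0.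
(* Half of the rate absorbs the factor t left by the number of grid points per unit length. *)
have [C' C0' HC'] := @pow_le_expR 1 _ c20.
exists (m.+1`!%:R * C * expR 2^-1 * C'), ((4 * q)^-1 / 2).
have f0 : 0 < m.+1`!%:R :> R by rewrite ltr0n fact_gt0.
split => //; first by rewrite !mulr_gt0// expR_gt0.
move=> s t e ht e0; have t_gt0 := lt_trans t0_gt0 ht.
have [N HN] := pow_fact_le_expR q0 t_gt0.
have [M0 HM0] := HC N m t s e ht e0.
exists M0 => M /(HM0 M s) h; apply: (le_trans (h _)).
  by rewrite lexx lerDl ltW.
rewrite lerD2l.
apply: (@le_trans _ _ (m.+1`!%:R * C * t * ((q / t) ^+ N * N`!%:R))).
  rewrite (_ : q / t = m.+2%:R * (alpha / t)); last by rewrite /q mulrA.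
  rewrite [(_ * (alpha / t)) ^+ N]exprMn.
  have -> : m.+1`!%:R * C * t * (m.+2%:R ^+ N * (alpha / t) ^+ N * N`!%:R) =
    (alpha / t) ^+ N * ((m.+1`!%:R * m.+2%:R ^+ N * N`!%:R) * C * t) by ring.
  have at0 : 0 <= alpha / t by rewrite divr_ge0 ?ltW.
  apply: ler_wpM2l; first exact: exprn_ge0.
  apply: ler_wpM2r; first exact: ltW.
  apply: ler_wpM2r; first exact: ltW.
  by rewrite -natrX -!natrM ler_nat fact_addn_le.
apply: (@le_trans _ _ (m.+1`!%:R * C * t * (expR 2^-1 * expR (- ((4 * q)^-1 * t))))).
  by rewrite ler_wpM2l// !mulr_ge0 ?ltW.
have -> : - ((4 * q)^-1 * t) = - ((4 * q)^-1 / 2 * t) + - ((4 * q)^-1 / 2 * t) by lra.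
rewrite expRD; set E := expR (- ((4 * q)^-1 / 2 * t)).
have tE : t * E <= C'.
  rewrite /E expRN ler_pdivrMr ?expR_gt0//.
  by have := HC' t (ltW t_gt0); rewrite expr1.
have -> : m.+1`!%:R * C * t * (expR 2^-1 * (E * E)) =
  (m.+1`!%:R * C * expR 2^-1 * E) * (t * E) by ring.
have -> : m.+1`!%:R * C * expR 2^-1 * C' * E =
  (m.+1`!%:R * C * expR 2^-1 * E) * C' by ring.
by rewrite ler_wpM2l// !mulr_ge0 ?expR_ge0 ?ltW.
Qed.

End Decay.

(** * Integrals and means *)

Section LorentzIntegral.
Context (R : realType).
Local Notation mu := (@lebesgue_measure R).

Lemma lorentz_gt0 (x : R) : 0 < (1 + x ^+ 2)^-1.
Proof. by rewrite invr_gt0 ltr_wpDr ?sqr_ge0. Qed.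

Lemma continuous_lorentz : continuous (fun x : R => (1 + x ^+ 2)^-1).
Proof.
move=> x; apply: cvgV; first by rewrite gt_eqF// ltr_wpDr ?sqr_ge0.
apply: cvgD; first exact: cvg_cst.
exact: exprn_continuous.
Qed.

Lemma integrable_lorentz :
  mu.-integrable [set: R] (EFin \o (fun x : R => (1 + x ^+ 2)^-1)).
Proof.
have mf : measurable_fun [set: R] (fun x : R => (1 + x ^+ 2)^-1).
  exact: continuous_measurable_fun continuous_lorentz.
apply/integrableP; split; first exact/measurable_EFinP.
under eq_integral => x _ do rewrite /= ger0_norm ?(ltW (lorentz_gt0 _))//.
rewrite ge0_symfun_integralT/=.
- rewrite (_ : [set x | _]%classic = `[0, +oo[%classic); last first.
    by apply/seteqP; split => x/=; rewrite in_itv/= andbT.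
  rewrite (@ge0_continuous_FTC2y R _ atan 0 (pi / 2)).
  + by rewrite -EFinB -EFinM ltry.
  + by move=> x _; rewrite ltW// lorentz_gt0.
  + by apply: continuous_subspaceT => x; exact: continuous_lorentz.
  + exact: cvgy_atan.
  + by move=> x _; exact: derivable_atan.
  + by apply: cvg_at_right_filter; exact: continuous_atan.
  + by move=> x _; exact: derive1_atan.
- by move=> x; rewrite ltW// lorentz_gt0.
- exact: continuous_lorentz.
- by move=> x; rewrite /= sqrrN.
Qed.

Lemma integrable_le_lorentz (f : R -> R) (K : R) : 0 <= K -> continuous f ->
  (forall x, `|f x| <= K * (1 + x ^+ 2)^-1) ->
  mu.-integrable [set: R] (EFin \o f).
Proof.
move=> K0 cf fK.
have iK : mu.-integrable [set: R] (fun x => K%:E * ((1 + x ^+ 2)^-1)%:E)%E.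
  exact: integrableZl integrable_lorentz.
apply: le_integrable iK => //.
  by apply/measurable_EFinP; exact: (continuous_measurable_fun cf).
move=> x _; rewrite /= lee_fin.
by rewrite (ger0_norm (_ : 0 <= K * _)) ?fK// mulr_ge0// ltW// lorentz_gt0.
Qed.

(** Dominated convergence reduces the integral to the intervals [-n-1, n+1], where only boundary
    values of [F] remain; these tend to 0. *)
Lemma Rintegral_derive_eq0 (F f : R -> R) (K : R) : 0 <= K ->
  (forall x, is_derive x (1 : R) F (f x)) -> continuous f ->
  (forall x, `|f x| <= K * (1 + x ^+ 2)^-1) ->
  (forall x, `|F x| <= K * (1 + x ^+ 2)^-1) ->
  \int[mu]_x f x = 0.
Proof.
move=> K0 dF cf fK FK.
have cF : continuous F.
  move=> x; apply/differentiable_continuous/derivable1_diffP.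
  exact: (@ex_derive _ _ _ _ _ _ _ (dF x)).
pose f_ (n : nat) := (EFin \o f) \_ `[- n.+1%:R, n.+1%:R].
have mf : measurable_fun [set: R] (EFin \o f).
  by apply/measurable_EFinP; exact: (continuous_measurable_fun cf).
have [||||_ _ cvg] := @dominated_convergence _ _ R mu setT measurableT f_ (EFin \o f)
  (fun x => K%:E * ((1 + x ^+ 2)^-1)%:E)%E _ mf.
- by move=> n; apply/(measurable_restrictT _ _).1 => //; exact: measurable_funTS.
- apply: aeW => /= x _; apply: cvg_near_cst; near=> n.
  rewrite /f_ patchE mem_set//= in_itv/= -ler_norml.
  apply: ltW; apply: (@lt_le_trans _ _ n%:R); last by rewrite ler_nat.
  by near: n; exact: nbhs_infty_gtr.
- exact: integrableZl integrable_lorentz.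
- apply: aeW => /= x n _; rewrite /f_ patchE; case: ifP => _.
    by rewrite /= -EFinM lee_fin fK.
  by rewrite abse0 -EFinM lee_fin mulr_ge0// ltW// lorentz_gt0.
rewrite /Rintegral.
suff -> : (\int[mu]_x (f x)%:E = 0)%E by [].
apply: (cvg_unique (@ereal_hausdorff R) cvg).
have -> : [sequence (\int[mu]_x f_ n x)%E]_n =
    EFin \o (fun n : nat => F n.+1%:R - F (- n.+1%:R)).
  apply/funext => n /=; rewrite /f_ -integral_mkcond.
  rewrite (@continuous_FTC2 R f F (- n.+1%:R) n.+1%:R).
  - by rewrite EFinB.
  - by rewrite -subr_gt0 opprK addr_gt0.
  - by apply: continuous_subspaceT => x; exact: cf.
  - split.
    + by move=> x _; exact: (@ex_derive _ _ _ _ _ _ _ (dF x)).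
    + by apply: cvg_at_right_filter; exact: cF.
    + by apply: cvg_at_left_filter; exact: cF.
  - by move=> x _; rewrite derive1E; exact: (@derive_val _ _ _ _ _ _ _ (dF x)).
apply: cvg_EFin; first exact: nearW.
apply/cvgrPdist_le => /= e e0.
have e20 : 0 < e / 2 by rewrite divr_gt0.
have [X X0 HX] := lorentz_tail K0 e20 FK.
near=> n; rewrite sub0r normrN.
apply: (le_trans (ler_normB _ _)).
have Xn : X <= n.+1%:R.
  apply: ltW; apply: (@lt_le_trans _ _ n%:R); last by rewrite ler_nat.
  by near: n; exact: nbhs_infty_gtr.
have h1 := HX n.+1%:R; have h2 := HX (- n.+1%:R).
rewrite ?normrN ger0_norm// in h1 h2.
by have := h1 Xn; have := h2 Xn; lra.
Unshelve. all: by end_near. Qed.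

(** This positivity lets the vanishing of an integral be read as the vanishing of the coefficient of
    the Gaussian. *)
Lemma Rintegral_gauss_gt0 (a : R) : 0 < a -> 0 < \int[mu]_x gaussd a 0 x.
Proof.
move=> a0.
have cg : continuous (gaussd a 0).
  move=> x; apply/differentiable_continuous/derivable1_diffP.
  exact: (@ex_derive _ _ _ _ _ _ _ (is_derive_gaussd a 0 x)).
have ig : mu.-integrable [set: R] (EFin \o gaussd a 0).
  apply: (@integrable_le_lorentz _ (gauss_cst a)) => //.
    exact/ltW/gauss_cst_gt0.
  by move=> x; have := gaussd_bound a0 0 x; rewrite fact0 mul1r.
have h : ((expR (- a))%:E <= \int[mu]_x (gaussd a 0 x)%:E)%E.
  apply: (@le_trans _ _ (\int[mu]_(x in `[0%R, 1%R]) (gaussd a 0 x)%:E)%E).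
    apply: (@le_trans _ _ (\int[mu]_(x in `[0%R, 1%R]) (expR (- a))%:E)%E).
      rewrite integral_cst//= lebesgue_measure_itv/= lte_fin ltr01.
      by rewrite oppr0 adde0 mule1.
    apply: ge0_le_integral => //.
    - apply/measurable_EFinP/measurable_funTS.
      exact: continuous_measurable_fun.
    - move=> x; rewrite /= in_itv/= => /andP[x0 x1].
      rewrite lee_fin ler_expR lerN2 ler_piMr ?(ltW a0)//.
      by rewrite expr_le1.
  apply: ge0_subset_integral => //.
  - by apply/measurable_EFinP; exact: continuous_measurable_fun.
  - by move=> x _; rewrite lee_fin expR_ge0.
apply: (@lt_le_trans _ _ (expR (- a))); first exact: expR_gt0.
rewrite /Rintegral -lee_fin fineK//.
exact: integrable_fin_num.
Qed.

End LorentzIntegral.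

Section MeanValue.
Context (R : realType) (a alpha t0 : R).
Hypotheses (a_gt0 : 0 < a) (alpha_gt0 : 0 < alpha) (t0_gt0 : 0 < t0).
Local Notation mu := (@lebesgue_measure R).
Local Notation g := (gaussd a).

(* [c] is the coefficient of the Gaussian itself when [f] is expanded in the
   derivatives of the Gaussian. *)
Definition has_mean (f : R -> R) (c : R) :=
  [/\ continuous f, \int[mu]_x f x = c * \int[mu]_x g 0 x,
      exp_small t0 (fun s t M => box_sum f alpha t s M - c * box_sum (g 0) alpha t s M) &
      exists2 K : R, 0 <= K & forall x, `|f x| <= K * (1 + x ^+ 2)^-1].

Lemma box_sum_lin (f1 f2 : R -> R) (l1 l2 t s : R) M :
  box_sum (fun x => l1 * f1 x + l2 * f2 x) alpha t s M =
  l1 * box_sum f1 alpha t s M + l2 * box_sum f2 alpha t s M.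
Proof. by rewrite /box_sum !mulr_sumr -big_split. Qed.

Lemma has_mean_lin (f1 f2 : R -> R) (c1 c2 l1 l2 : R) :
  has_mean f1 c1 -> has_mean f2 c2 ->
  has_mean (fun x => l1 * f1 x + l2 * f2 x) (l1 * c1 + l2 * c2).
Proof.
move=> [cf1 i1 s1 [K1 K10 fK1]] [cf2 i2 s2 [K2 K20 fK2]].
have if1 := integrable_le_lorentz K10 cf1 fK1.
have if2 := integrable_le_lorentz K20 cf2 fK2.
split.
- move=> x; apply: cvgD.
    by apply: cvgM; [exact: cvg_cst|exact: cf1].
  by apply: cvgM; [exact: cvg_cst|exact: cf2].
- rewrite RintegralD//; [|exact: (integrableZl _ l1 if1)|exact: (integrableZl _ l2 if2)].
  by rewrite !RintegralZl// i1 i2; ring.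
- apply: exp_small_ext (exp_small_add t0_gt0 (exp_small_scale t0_gt0 l1 s1)
      (exp_small_scale t0_gt0 l2 s2)) => s t M /=.
  by rewrite box_sum_lin; ring.
- exists (`|l1| * K1 + `|l2| * K2); first by rewrite addr_ge0// mulr_ge0.
  move=> x; apply: (le_trans (ler_normD _ _)); rewrite !normrM mulrDl.
  by apply: lerD; rewrite -mulrA ler_wpM2l.
Qed.

Lemma has_mean_gaussd m : has_mean (g m) (m == 0%N)%:R.
Proof.
have cg k : continuous (g k).
  move=> x; apply/differentiable_continuous/derivable1_diffP.
  exact: (@ex_derive _ _ _ _ _ _ _ (is_derive_gaussd a k x)).
have gK k x : `|g k x| <= k`!%:R * gauss_cst a * (1 + x ^+ 2)^-1.
  by rewrite -mulrA gaussd_bound.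
have K0 k : 0 <= k`!%:R * gauss_cst a.
  by rewrite mulr_ge0// ltW// gauss_cst_gt0.
split; first exact: cg.
- case: m => [|m] /=; first by rewrite mul1r.
  rewrite mul0r; pose K := m`!%:R * gauss_cst a + m.+1`!%:R * gauss_cst a.
  apply: (@Rintegral_derive_eq0 R (g m) _ K).
  + by rewrite addr_ge0.
  + exact: is_derive_gaussd.
  + exact: cg.
  + move=> x; apply: (le_trans (gK _ _)).
    by rewrite ler_wpM2r ?(ltW (lorentz_gt0 _))// lerDr.
  + move=> x; apply: (le_trans (gK _ _)).
    by rewrite ler_wpM2r ?(ltW (lorentz_gt0 _))// lerDl.
- case: m => [|m] /=.
    by apply: exp_small_ext (exp_small0 t0 R) => s t M; rewrite mul1r subrr.
  apply: exp_small_ext (exp_small_box_sum alpha_gt0 t0_gt0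
    (gauss_cst_gt0 a_gt0) (is_derive_gaussd a) (gaussd_bound a_gt0) m) => s t M.
  by rewrite mul0r subr0.
- by exists (m`!%:R * gauss_cst a).
Qed.

(** All orders [m] are treated at once, because multiplication by x moves the order of the
    derivative both up and down by one. *)
Lemma has_mean_monomial k m : exists c, has_mean (fun x => x ^+ k * g m x) c.
Proof.
elim: k m => [|k IH] m.
  exists (m == 0%N)%:R.
  rewrite (_ : (fun x => _) = g m); first exact: has_mean_gaussd.
  by apply/funext => x; rewrite expr0 mul1r.
case: m => [|m].
  have [c hc] := IH 1%N.
  (* The zero summand brings a one-term identity into the form required by [has_mean_lin]. *)
  exists (- (2 * a)^-1 * c + 0 * c).
  rewrite (_ : (fun x => _) = (fun x => - (2 * a)^-1 * (x ^+ k * g 1 x) + 0 * (x ^+ k * g 1 x))).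
    exact: has_mean_lin.
  by apply/funext => x; rewrite exprSr -mulrA mulx_gaussd0//; ring.
have [c hc] := IH m.+2; have [c' hc'] := IH m.
exists (- (2 * a)^-1 * c + (- m.+1%:R) * c').
rewrite (_ : (fun x => _) = (fun x => - (2 * a)^-1 * (x ^+ k * g m.+2 x) + (- m.+1%:R) * (x ^+ k * g m x))).
  exact: has_mean_lin.
by apply/funext => x; rewrite exprSr -mulrA mulx_gaussd//; ring.
Qed.

End MeanValue.

Section IteratedIntegral.
Context (R : realType).
Local Notation mu := (@lebesgue_measure R).

Lemma Rintegral_sum (T : Type) (l : seq T) (h : T -> R -> R) :
  (forall p, mu.-integrable [set: R] (EFin \o h p)) ->
  mu.-integrable [set: R] (EFin \o (fun x => \sum_(p <- l) h p x)) /\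
  \int[mu]_x (\sum_(p <- l) h p x) = \sum_(p <- l) \int[mu]_x h p x.
Proof.
move=> ih; elim: l => [|p l [IH1 IH2]].
  split.
    rewrite (_ : _ \o _ = cst 0%E); first exact: integrable0.
    by apply/funext => x /=; rewrite big_nil.
  under eq_Rintegral => x _ do rewrite big_nil.
  by rewrite big_nil Rintegral_cst// mul0r.
split.
  rewrite (_ : _ \o _ = (EFin \o h p) \+ (EFin \o (fun x => (\sum_(p <- l) h p x)%R)))%E.
    exact: integrableD.
  by apply/funext => x /=; rewrite big_cons EFinD.
under eq_Rintegral => x _ do rewrite big_cons.
by rewrite RintegralD// IH2 big_cons.
Qed.

(** The inner variables are integrated first, and the factor in the outer variable then belongs to
    the coefficients. Hence the induction is on [n] for an arbitrary list with arbitrary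
    coefficients, and integrability is only checked in one variable. *)
Lemma Rn_integral_sum_prod (f : nat -> R -> R) :
  (forall k, mu.-integrable [set: R] (EFin \o f k)) ->
  forall n (l : seq (R * ('I_n -> nat))),
  Rn_integral (fun y : 'rV[R]_n => \sum_(p <- l) p.1 * \prod_j f (p.2 j) (y 0 j))
  = \sum_(p <- l) p.1 * \prod_j (\int[mu]_x f (p.2 j) x).
Proof.
move=> fi; elim=> [|n IH] l /=.
  by apply: eq_bigr => p _; rewrite !big_ord0.
have E x : Rn_integral (fun y : 'rV[R]_n => \sum_(p <- l)
      p.1 * \prod_j f (p.2 j) (row_mx x%:M y 0 j)) =
    \sum_(p <- l) p.1 * \prod_(j < n) (\int[mu]_x f (p.2 (lift ord0 j)) x) * f (p.2 ord0) x.
  have := IH [seq (p.1 * f (p.2 ord0) x, fun j => p.2 (lift ord0 j)) | p <- l].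
  rewrite big_map /= => H.
  under [RHS]eq_bigr => p _ do rewrite mulrAC.
  rewrite -H; congr Rn_integral; apply/funext => y.
  rewrite big_map; apply: eq_bigr => p _ /=; rewrite big_ord_recl mulrA.
  congr (_ * f _ _ * _).
    transitivity (row_mx x%:M y 0 (lshift n ord0)).
      by congr (row_mx _ _ _ _); exact: val_inj.
    by rewrite row_mxEl mxE eqxx mulr1n.
  apply: eq_bigr => j _; congr (f _ _).
  transitivity (row_mx x%:M y 0 (rshift 1 j)); last by rewrite row_mxEr.
  by congr (row_mx _ _ _ _); exact: val_inj.
under eq_Rintegral => x _ do rewrite E.
have [|_ ->] := @Rintegral_sum _ l (fun p x => p.1 *
    \prod_(j < n) (\int[mu]_x f (p.2 (lift ord0 j)) x) * f (p.2 ord0) x).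
  by move=> p; exact: (integrableZl _ _ (fi _)).
apply: eq_bigr => p _; rewrite RintegralZl// big_ord_recl.
by rewrite -mulrA; congr (_ * _); rewrite mulrC.
Qed.

End IteratedIntegral.

(** * Polynomials times Gaussians in several variables *)

Section PolynomialFamily.
Context (R : realType) (n : nat) (Z : Type) (N : Z -> R).
Hypothesis N_ge0 : forall z, 0 <= N z.

(** Polynomial growth in (w, y_m) is used only in this form: an arbitrarily small part of a Gaussian
    exp (- c N) absorbs it. *)
Definition tame (a : Z -> R) := forall d : R, 0 < d -> exists2 C : R, 0 < C &
  forall z, `|a z| <= C * expR (d * N z).

(** Polynomials in y whose coefficients are tame functions of z. Being generated by monomials and
    sums, they need the mean value estimates only for monomials, where the grid sum factorizes. *)
Inductive ypoly : ('rV[R]_n -> Z -> R) -> Prop :=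
| ypoly_mono (k : 'I_n -> nat) a : tame a ->
    ypoly (fun y z => a z * \prod_j y 0 j ^+ k j)
| ypoly_add Q1 Q2 : ypoly Q1 -> ypoly Q2 ->
    ypoly (fun y z => Q1 y z + Q2 y z).

Lemma tame_cst c : tame (fun=> c).
Proof.
move=> d d0; exists (`|c| + 1); first by rewrite ltr_wpDl.
move=> z; rewrite -[leLHS]mulr1; apply: ler_pM => //; first by rewrite lerDl.
by apply: le_trans (expR_ge1Dx _); rewrite lerDl mulr_ge0// ltW.
Qed.

Lemma tame_mul a b : tame a -> tame b -> tame (fun z => a z * b z).
Proof.
move=> ha hb d d0; have d20 : 0 < d / 2 by rewrite divr_gt0.
have [C C0 HC] := ha _ d20; have [C' C0' HC'] := hb _ d20.
exists (C * C'); first exact: mulr_gt0.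
move=> z; rewrite normrM.
have -> : d * N z = d / 2 * N z + d / 2 * N z by lra.
by rewrite expRD mulrACA ler_pM.
Qed.

Lemma tame_add a b : tame a -> tame b -> tame (fun z => a z + b z).
Proof.
move=> ha hb d d0; have [C C0 HC] := ha _ d0; have [C' C0' HC'] := hb _ d0.
exists (C + C'); first exact: addr_gt0.
by move=> z; apply: (le_trans (ler_normD _ _)); rewrite mulrDl lerD.
Qed.

Lemma tame_prod (I : Type) (r : seq I) (b : I -> Z -> R) :
  (forall i, tame (b i)) -> tame (fun z => \prod_(i <- r) b i z).
Proof.
move=> hb; elim: r => [|i r IH].
  by rewrite (_ : (fun z => _) = fun=> 1); [exact: tame_cst|apply/funext => z; rewrite big_nil].
rewrite (_ : (fun z => _) = fun z => b i z * \prod_(j <- r) b j z).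
  exact: tame_mul.
by apply/funext => z; rewrite big_cons.
Qed.

Lemma tame_exp a k : tame a -> tame (fun z => a z ^+ k).
Proof.
move=> ha; rewrite (_ : (fun z => _) = fun z => \prod_(i <- nseq k tt) a z).
  exact: (tame_prod _ (fun=> ha)).
by apply/funext => z; rewrite big_const_seq count_predT size_nseq iter_mulr_1.
Qed.

Lemma tame_le (a : Z -> R) (K : R) : 0 <= K -> (forall z, `|a z| <= K * (1 + N z)) -> tame a.
Proof.
move=> K0 aK d d0; have dV : 0 < d^-1 by rewrite invr_gt0.
exists ((K + 1) * (1 + d^-1)).
  by apply: mulr_gt0; lra.
move=> z; apply: (le_trans (aK z)); rewrite -mulrA.
apply: ler_pM; rewrite ?addr_ge0 ?N_ge0//; first lra.
have h := expR_ge1Dx (d * N z).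
have h2 : d^-1 * (1 + d * N z) <= d^-1 * expR (d * N z) by rewrite ler_pM2l.
have e : d^-1 * (1 + d * N z) = d^-1 + N z by field; rewrite gt_eqF.
have h3 : 1 <= expR (d * N z).
  by apply: le_trans h; rewrite lerDl mulr_ge0 ?N_ge0// ltW.
rewrite mulrDl mul1r; lra.
Qed.

Lemma ypoly_ext Q Q' : (forall y z, Q y z = Q' y z) -> ypoly Q -> ypoly Q'.
Proof.
move=> QQ'; rewrite (_ : Q = Q')//.
by apply/funext => y; apply/funext => z.
Qed.

Lemma ypoly_tame a : tame a -> ypoly (fun _ z => a z).
Proof.
move=> ha; apply: ypoly_ext (ypoly_mono (fun=> 0%N) ha) => y z.
by rewrite big1 ?mulr1// => j _; rewrite expr0.
Qed.

Lemma ypoly_cst c : ypoly (fun _ _ => c).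
Proof. exact: ypoly_tame (tame_cst c). Qed.

Lemma ypoly_coord j : ypoly (fun y _ => y 0 j).
Proof.
apply: ypoly_ext (ypoly_mono (fun i => (i == j) : nat) (tame_cst 1)) => y z.
rewrite mul1r (bigD1 j)//= eqxx expr1 big1 ?mulr1// => i /negPf ->.
by rewrite expr0.
Qed.

Lemma ypoly_mul Q1 Q2 : ypoly Q1 -> ypoly Q2 ->
  ypoly (fun y z => Q1 y z * Q2 y z).
Proof.
move=> h1 h2; elim: h1 => [k a ha|A B hA IHA hB IHB]; last first.
  by apply: ypoly_ext (ypoly_add IHA IHB) => y z; rewrite mulrDl.
elim: h2 => [k' b hb|A B hA IHA hB IHB]; last first.
  by apply: ypoly_ext (ypoly_add IHA IHB) => y z; rewrite mulrDr.
apply: ypoly_ext (ypoly_mono (fun j => (k j + k' j)%N) (tame_mul ha hb)) => y z.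
rewrite mulrACA -big_split/=; congr (_ * _).
by apply: eq_bigr => j _; rewrite exprD.
Qed.

Context (a alpha t0 : R).
Hypotheses (a_gt0 : 0 < a) (alpha_gt0 : 0 < alpha) (t0_gt0 : 0 < t0).
Local Notation mu := (@lebesgue_measure R).
Local Notation g0 := (gaussd a 0).

(** With F, C, G the products over the remaining indices, f F - c C g G = (f - c g) F + (F - C G) c
    g. The first term needs [F] to be subexponential, so both claims go through the induction
    together. *)
Lemma exp_small_prod (I : Type) (r : seq I) (f g : I -> R -> R -> nat -> R)
    (c : I -> R) :
  (forall j, exp_small t0 (fun s t M => f j s t M - c j * g j s t M)) ->
  (forall j, subexp t0 (f j)) -> (forall j, subexp t0 (g j)) ->
  exp_small t0 (fun (s : I -> R) t M => \prod_(j <- r) f j (s j) t M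
      - \prod_(j <- r) c j * \prod_(j <- r) g j (s j) t M) /\
  subexp t0 (fun (s : I -> R) t M => \prod_(j <- r) f j (s j) t M).
Proof.
move=> hd hf hg; elim: r => [|i r [IH1 IH2]].
  split.
    by apply: exp_small_ext (exp_small0 t0 (I -> R)) => s t M; rewrite !big_nil mulr1 subrr.
  move=> d d0; have [C C0 HC] := subexp_cst t0_gt0 (I -> R) 1 d0.
  by exists C => // s t M ht; rewrite big_nil; exact: HC.
have hg' : subexp t0 (fun (s : I -> R) t M => c i * g i (s i) t M).
  apply: (subexp_mul (subexp_cst t0_gt0 (I -> R) (c i))).
  exact: (subexp_comp (fun s : I -> R => s i) (hg i)).
have hd' := exp_small_comp (fun s : I -> R => s i) (hd i).
split.
  apply: exp_small_ext (exp_small_add t0_gt0 (exp_small_mul hd' IH2) (exp_small_mul IH1 hg')) => s t M.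
  by rewrite !big_cons; ring.
have hf' := subexp_comp (fun s : I -> R => s i) (hf i).
move=> d d0; have [C C0 HC] := subexp_mul hf' IH2 d0.
by exists C => // s t M ht; rewrite big_cons; exact: HC.
Qed.

Definition grid_point (t : R) (s : 'I_n -> R) (M : nat)
    (i : {ffun 'I_n -> 'I_M.*2.+1}) : 'rV[R]_n :=
  \row_j ((alpha * ((i j)%:R - M%:R) + s j) / t).

Definition grid_sum (Q : 'rV[R]_n -> R) (t : R) (s : 'I_n -> R) (M : nat) : R :=
  \sum_(i : {ffun 'I_n -> 'I_M.*2.+1})
     Q (grid_point t s i) * \prod_j g0 (grid_point t s i 0 j).

Lemma grid_sum_mono (k : 'I_n -> nat) c t s M :
  grid_sum (fun y => c * \prod_j y 0 j ^+ k j) t s M =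
  c * \prod_j box_sum (fun x => x ^+ k j * g0 x) alpha t (s j) M.
Proof.
rewrite /grid_sum /box_sum bigA_distr_bigA mulr_sumr; apply: eq_bigr => i _.
rewrite -mulrA -big_split/=; congr (_ * _).
by apply: eq_bigr => j _; rewrite mxE.
Qed.

(** The same [Qbar z] governs the integral over y and the grid sums, so a vanishing integral removes
    the main term of the sums. The last bound, which uses no cancellation, serves the fibres with
    y_m <> 0. *)
Lemma ypoly_mean Q : ypoly Q -> exists Qbar : Z -> R,
  [/\ forall z c, Rn_integral (fun y => c * (Q y z * \prod_j g0 (y 0 j))) =
        c * (Qbar z * (\int[mu]_x g0 x) ^+ n),
      forall d : R, 0 < d -> exists C1 C2 : R, [/\ 0 < C1, 0 < C2 &
        forall z (t e : R) s, t0 < t -> 0 < e ->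
        exists M0, forall M, (M0 <= M)%N ->
        `|grid_sum (Q ^~ z) t s M - Qbar z * \prod_j box_sum g0 alpha t (s j) M|
          <= e + C1 * expR (d * N z) * expR (- (C2 * t))] &
      forall d d' : R, 0 < d -> 0 < d' -> exists2 C : R, 0 < C &
        forall z (t : R) s M, t0 < t ->
        `|grid_sum (Q ^~ z) t s M| <= C * expR (d * N z) * expR (d' * t)].
Proof.
have /choice[c hc] := fun k => has_mean_monomial a_gt0 alpha_gt0 t0_gt0 k 0.
pose f k x : R := x ^+ k * g0 x.
have fi k : mu.-integrable [set: R] (EFin \o f k).
  have [cf _ _ [K K0 fK]] := hc k; exact: integrable_le_lorentz K0 cf fK.
have hg0 : subexp t0 (fun s t M => box_sum g0 alpha t s M).
  have [_ _ _ [K K0 fK]] := has_mean_gaussd a_gt0 alpha_gt0 t0_gt0 0.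
  exact: (subexp_box_sum alpha_gt0 t0_gt0 K0 fK).
have hf k : subexp t0 (fun s t M => box_sum (f k) alpha t s M).
  have [_ _ _ [K K0 fK]] := hc k.
  exact: (subexp_box_sum alpha_gt0 t0_gt0 K0 fK).
move=> hQ.
(* The induction on [ypoly] carries an explicit list of monomials, so that the iterated integral is
   evaluated once, for the whole list, by [Rn_integral_sum_prod]. *)
suff [l [lQ h2 h3]] : exists l : seq ((Z -> R) * ('I_n -> nat)),
  [/\ forall y z, Q y z = \sum_(p <- l) p.1 z * \prod_j y 0 j ^+ p.2 j,
      forall d : R, 0 < d -> exists C1 C2 : R, [/\ 0 < C1, 0 < C2 &
        forall z (t e : R) s, t0 < t -> 0 < e ->
        exists M0, forall M, (M0 <= M)%N ->
        `|grid_sum (Q ^~ z) t s M - (\sum_(p <- l) p.1 z * \prod_j c (p.2 j))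
             * \prod_j box_sum g0 alpha t (s j) M|
          <= e + C1 * expR (d * N z) * expR (- (C2 * t))] &
      forall d d' : R, 0 < d -> 0 < d' -> exists2 C : R, 0 < C &
        forall z (t : R) s M, t0 < t ->
        `|grid_sum (Q ^~ z) t s M| <= C * expR (d * N z) * expR (d' * t)].
  exists (fun z => \sum_(p <- l) p.1 z * \prod_j c (p.2 j)); split => // z b.
  have := @Rn_integral_sum_prod R f fi n [seq (b * p.1 z, p.2) | p <- l].
  rewrite big_map mulr_suml mulr_sumr /= => H.
  rewrite (_ : (fun y : 'rV[R]_n => _) = (fun y : 'rV[R]_n => \sum_(p <- [seq (b * p.1 z, p.2) | p <- l])
      p.1 * \prod_j f (p.2 j) (y 0 j))).
    rewrite H; apply: eq_bigr => p _; rewrite -!mulrA; congr (_ * (_ * _)).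
    under eq_bigr => j _ do have [_ -> _ _] := hc (p.2 j).
    by rewrite big_split/= prodr_const card_ord.
  apply/funext => y; rewrite lQ big_map mulr_suml mulr_sumr; apply: eq_bigr => p _ /=.
  by rewrite -!mulrA -big_split.
elim: hQ => [k b hb|Q1 Q2 _ [l1 [lQ1 h12 h13]] _ [l2 [lQ2 h22 h23]]].
  exists [:: (b, k)]; split.
  - by move=> y z; rewrite big_seq1.
  - move=> d d0; have [C C0 HC] := hb d d0.
    have hd j : exp_small t0 (fun s t M => box_sum (f (k j)) alpha t s M - c (k j) * box_sum g0 alpha t s M).
      by have [] := hc (k j).
    have [[C1 [C2 [C10 C20 H]]] _] := exp_small_prod (index_enum 'I_n) hd (fun j => hf (k j)) (fun=> hg0).
    exists (C * C1), C2; split => //; first exact: mulr_gt0.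
    move=> z t e s ht e0; have E0 : 0 < C * expR (d * N z) by rewrite mulr_gt0 ?expR_gt0.
    have [M0 HM0] := H s t _ ht (divr_gt0 e0 E0).
    exists M0 => M /HM0 h; rewrite grid_sum_mono big_seq1 /= -mulrA -mulrBr normrM.
    apply: (le_trans (ler_pM _ _ (HC z) h)) => //.
    rewrite mulrDr mulrCA divff ?gt_eqF// mulr1 lerD2l le_eqVlt; apply/orP; left.
    by apply/eqP; ring.
  - move=> d d' d0 d0'; have [C C0 HC] := hb d d0.
    have hd j : exp_small t0 (fun s t M => box_sum (f (k j)) alpha t s M - c (k j) * box_sum g0 alpha t s M).
      by have [] := hc (k j).
    have [_ H] := exp_small_prod (index_enum 'I_n) hd (fun j => hf (k j)) (fun=> hg0).
    have [C' C0' HC'] := H d' d0'.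
    exists (C * C'); first exact: mulr_gt0.
    move=> z t s M ht; rewrite grid_sum_mono normrM.
    apply: (le_trans (ler_pM _ _ (HC z) (HC' s t M ht))) => //.
    by rewrite mulrACA -!mulrA.
have gsD z t s M : grid_sum (fun y => Q1 y z + Q2 y z) t s M =
    grid_sum (Q1 ^~ z) t s M + grid_sum (Q2 ^~ z) t s M.
  by rewrite /grid_sum -big_split; apply: eq_bigr => i _; rewrite mulrDl.
exists (l1 ++ l2); split.
- by move=> y z; rewrite big_cat/= -lQ1 -lQ2.
- move=> d d0; have [C1 [C2 [C10 C20 H]]] := h12 d d0.
  have [C1' [C2' [C10' C20' H']]] := h22 d d0.
  pose m := Num.min C2 C2'.
  exists (C1 + C1'), m; split; [exact: addr_gt0|by rewrite lt_min C20|].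
  move=> z t e s ht e0; have e20 : 0 < e / 2 by rewrite divr_gt0.
  have t_ge0 : 0 <= t by rewrite ltW// (lt_trans t0_gt0).
  have [M0 HM] := H z t _ s ht e20; have [M0' HM'] := H' z t _ s ht e20.
  exists (maxn M0 M0') => M; rewrite geq_max => /andP[/HM h /HM' h'].
  rewrite gsD big_cat/= mulrDl opprD addrACA.
  apply: (le_trans (ler_normD _ _)); apply: (le_trans (lerD h h')).
  have l1' : C1 * expR (d * N z) * expR (- (C2 * t)) <= C1 * expR (d * N z) * expR (- (m * t)).
    apply: ler_wpM2l; first by rewrite mulr_ge0 ?expR_ge0// ltW.
    by rewrite ler_expR lerN2 ler_wpM2r// ge_min lexx.
  have l2' : C1' * expR (d * N z) * expR (- (C2' * t)) <= C1' * expR (d * N z) * expR (- (m * t)).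
    apply: ler_wpM2l; first by rewrite mulr_ge0 ?expR_ge0// ltW.
    by rewrite ler_expR lerN2 ler_wpM2r// ge_min lexx orbT.
  by rewrite !mulrDl; lra.
- move=> d d' d0 d0'; have [C C0 HC] := h13 d d' d0 d0'.
  have [C' C0' HC'] := h23 d d' d0 d0'.
  exists (C + C'); first exact: addr_gt0.
  move=> z t s M ht; rewrite gsD !mulrDl.
  by apply: (le_trans (ler_normD _ _)); apply: lerD; [exact: HC|exact: HC'].
Qed.

End PolynomialFamily.

(** * The quadratic form on real points *)

Section CauchySchwarz.
Context (R : realFieldType).

(** Lagrange's identity: twice the difference of the two sides is the double sum of d_i d_j (x_i y_j
    - x_j y_i)^2. *)
Lemma cauchy_schwarz (I : finType) (P : pred I) (d x y : I -> R) :
  (forall i, P i -> 0 <= d i) ->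
  (\sum_(i | P i) d i * (x i * y i)) ^+ 2 <=
  (\sum_(i | P i) d i * x i ^+ 2) * (\sum_(i | P i) d i * y i ^+ 2).
Proof.
move=> d0.
have E : \sum_(i | P i) \sum_(j | P j) d i * d j * (x i * y j - x j * y i) ^+ 2 =
   2 * ((\sum_(i | P i) d i * x i ^+ 2) * (\sum_(i | P i) d i * y i ^+ 2)
       - (\sum_(i | P i) d i * (x i * y i)) ^+ 2).
  transitivity (\sum_(i | P i) \sum_(j | P j) ((d i * x i ^+ 2) * (d j * y j ^+ 2))
     + \sum_(i | P i) \sum_(j | P j) ((d j * x j ^+ 2) * (d i * y i ^+ 2))
     - 2 * \sum_(i | P i) \sum_(j | P j) ((d i * (x i * y i)) * (d j * (x j * y j)))).
    rewrite mulr_sumr -sumrN -!big_split/=; apply: eq_bigr => i _.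
    by rewrite mulr_sumr -sumrN -!big_split/=; apply: eq_bigr => j _; ring.
  rewrite [X in _ + X - _]exchange_big/= -big_distrlr/=.
  by rewrite -[in X in _ - _ * X]big_distrlr/=; ring.
have : 0 <= \sum_(i | P i) \sum_(j | P j) d i * d j * (x i * y j - x j * y i) ^+ 2.
  by apply: sumr_ge0 => i Pi; apply: sumr_ge0 => j Pj; rewrite mulr_ge0 ?sqr_ge0// mulr_ge0 ?d0.
by rewrite E pmulr_rge0// subr_ge0.
Qed.

Definition nrm2 m (x : 'rV[R]_m) : R := \sum_i x 0 i ^+ 2.

Lemma nrm2_ge0 m (x : 'rV[R]_m) : 0 <= nrm2 x.
Proof. by apply: sumr_ge0 => i _; exact: sqr_ge0. Qed.

Lemma nrm2_coord m (x : 'rV[R]_m) i : x 0 i ^+ 2 <= nrm2 x.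
Proof.
by rewrite /nrm2 (bigD1 i)//= lerDl; apply: sumr_ge0 => j _; exact: sqr_ge0.
Qed.

Lemma nrm2Z m (c : R) (x : 'rV[R]_m) : nrm2 (c *: x) = c ^+ 2 * nrm2 x.
Proof.
by rewrite /nrm2 mulr_sumr; apply: eq_bigr => i _; rewrite mxE exprMn.
Qed.

Lemma nrm2D m (x y : 'rV[R]_m) : nrm2 (x + y) <= 2 * nrm2 x + 2 * nrm2 y.
Proof.
rewrite /nrm2 !mulr_sumr -big_split/=; apply: ler_sum => i _; rewrite mxE.
have := sqr_ge0 (x 0 i - y 0 i); nra.
Qed.

Lemma nrm2_mulmx m k (A : 'M[R]_(m, k)) :
  exists2 C : R, 0 < C & forall x : 'rV[R]_m, nrm2 (x *m A) <= C * nrm2 x.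
Proof.
exists (1 + \sum_j \sum_i A i j ^+ 2).
  by rewrite ltr_wpDr// sumr_ge0// => j _; apply: sumr_ge0 => i _; exact: sqr_ge0.
move=> x; apply: (@le_trans _ _ ((\sum_j \sum_i A i j ^+ 2) * nrm2 x)); last first.
  by rewrite ler_wpM2r ?nrm2_ge0// lerDr.
rewrite [leLHS]/nrm2 mulr_suml; apply: ler_sum => j _; rewrite mxE.
have := @cauchy_schwarz 'I_m xpredT (fun=> 1) (fun i => x 0 i) (fun i => A i j) (fun _ _ => ler01).
under eq_bigr => i _ do rewrite mul1r.
under [X in _ <= X * _ -> _]eq_bigr => i _ do rewrite mul1r.
under [X in _ <= _ * X -> _]eq_bigr => i _ do rewrite mul1r.
by rewrite mulrC.
Qed.

End CauchySchwarz.

Section RealForm.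
Context (R : realType) (V : vectType rat) (B : {symmetric V}).
Local Notation m := (\dim {:V}).
Local Notation fR := (@formR R V B).
Local Notation tR := (@to_real R V).

Lemma to_realP (c : rat) u v : tR (c *: u + v) = ratr c *: tR u + tR v.
Proof. by apply/rowP => i; rewrite !mxE linearP/= rmorphD rmorphM. Qed.

Lemma to_real0 : tR 0 = 0.
Proof. by apply/rowP => i; rewrite !mxE linear0 rmorph0. Qed.

Lemma to_realD u v : tR (u + v) = tR u + tR v.
Proof. by rewrite -[u]scale1r to_realP rmorph1 !scale1r. Qed.

Lemma to_realZ c u : tR (c *: u) = ratr c *: tR u.
Proof. by rewrite -[c *: u]addr0 to_realP to_real0 addr0. Qed.

Lemma to_realB u v : tR (u - v) = tR u - tR v.
Proof. by rewrite to_realD -scaleN1r to_realZ rmorphN1 scaleN1r. Qed.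

Lemma to_real_sum (I : Type) (r : seq I) (F : I -> V) :
  tR (\sum_(i <- r) F i) = \sum_(i <- r) tR (F i).
Proof.
elim: r => [|i r IH]; first by rewrite !big_nil to_real0.
by rewrite !big_cons to_realD IH.
Qed.

Lemma formRDl (x y z : realpts R V) : fR (x + y) z = fR x z + fR y z.
Proof. by rewrite /formR !mulmxDl mxE. Qed.

Lemma formRDr (x y z : realpts R V) : fR z (x + y) = fR z x + fR z y.
Proof. by rewrite /formR linearD/= mulmxDr mxE. Qed.

Lemma formRZl c (x z : realpts R V) : fR (c *: x) z = c * fR x z.
Proof. by rewrite /formR -!scalemxAl mxE. Qed.

Lemma formRZr c (x z : realpts R V) : fR z (c *: x) = c * fR z x.
Proof. by rewrite /formR linearZ/= -scalemxAr mxE. Qed.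

Lemma formRNl (x z : realpts R V) : fR (- x) z = - fR x z.
Proof. by rewrite -scaleN1r formRZl mulN1r. Qed.

Lemma formRNr (x z : realpts R V) : fR z (- x) = - fR z x.
Proof. by rewrite -scaleN1r formRZr mulN1r. Qed.

Lemma formR0l (z : realpts R V) : fR 0 z = 0.
Proof. by rewrite -(scale0r 0) formRZl mul0r. Qed.

Lemma formR0r (z : realpts R V) : fR z 0 = 0.
Proof. by rewrite -(scale0r 0) formRZr mul0r. Qed.

Lemma formR_suml (I : Type) (r : seq I) (F : I -> realpts R V) z :
  fR (\sum_(i <- r) F i) z = \sum_(i <- r) fR (F i) z.
Proof.
elim: r => [|i r IH]; first by rewrite !big_nil formR0l.
by rewrite !big_cons formRDl IH.
Qed.

Lemma formR_sumr (I : Type) (r : seq I) (F : I -> realpts R V) z :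
  fR z (\sum_(i <- r) F i) = \sum_(i <- r) fR z (F i).
Proof.
elim: r => [|i r IH]; first by rewrite !big_nil formR0r.
by rewrite !big_cons formRDr IH.
Qed.

Lemma B_sym u v : B u v = B v u.
Proof. by have := hermC B u v; rewrite /= expr0 mul1r. Qed.

Lemma formRC (x y : realpts R V) : fR x y = fR y x.
Proof.
rewrite /formR.
have E : (gramR R B)^T = gramR R B.
  by apply/matrixP => i j; rewrite !mxE B_sym.
transitivity ((x *m gramR R B *m y^T)^T 0 0); first by rewrite [RHS]mxE.
by rewrite !trmx_mul trmxK E mulmxA.
Qed.

Lemma to_real_basis (x : realpts R V) :
  x = \sum_k x 0 k *: tR (vbasis {:V})`_k.
Proof.
apply/rowP => i; rewrite summxE (bigD1 i)//= big1 => [|k ki].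
  rewrite addr0 !mxE coord_free ?(basis_free (vbasisP _))//.
  by rewrite eqxx rmorph1 mulr1.
rewrite !mxE coord_free ?(basis_free (vbasisP _))//.
by rewrite (negPf ki) rmorph0 mulr0.
Qed.

Lemma formR_to_real u v : fR (tR u) (tR v) = ratr (B u v).
Proof.
have bv w : w = \sum_i coord (vbasis {:V}) i w *: (vbasis {:V})`_i.
  by rewrite -coord_vbasis// memvf.
rewrite /formR mxE [in RHS](bv u) [in RHS](bv v).
rewrite linear_sumr/= rmorph_sum/=; apply: eq_bigr => j _.
rewrite linearZr/= rmorphM/= !mxE mulrC; congr (_ * _).
rewrite linear_sumlz/= rmorph_sum/=; apply: eq_bigr => i _.
by rewrite linearZl_LR/= rmorphM !mxE.
Qed.

Context (p : nat) (u u' : V).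
Hypotheses (sgB : has_signature B p 1) (isou : B u u = 0) (isou' : B u' u' = 0)
  (uu' : B u u' = - 2^-1).

Local Notation uR := (tR u).
Local Notation uR' := (tR u').
Local Notation W := (@Wreal R V B u u').

Lemma formR_uu : fR uR uR = 0.
Proof. by rewrite formR_to_real isou rmorph0. Qed.

Lemma formR_u'u' : fR uR' uR' = 0.
Proof. by rewrite formR_to_real isou' rmorph0. Qed.

Lemma formR_uu' : fR uR uR' = - 2^-1.
Proof. by rewrite formR_to_real uu' rmorphN fmorphV rmorph_nat. Qed.

Lemma formR_u'u : fR uR' uR = - 2^-1.
Proof. by rewrite formRC formR_uu'. Qed.

(* In orthogonal coordinates with one negative direction, [w] is orthogonal to
   [u + u'], which has norm [-1]; by Cauchy-Schwarz in the positive directions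
   the negative coordinate of [w] is dominated by the positive ones. *)
Lemma Wreal_posdef : exists2 c : R, 0 < c & forall w, W w -> nrm2 w <= c * fR w w.
Proof.
have [e [eb eo epos eneg]] := sgB.
pose T : 'M[R]_(p + 1, m) := \matrix_i tR e`_i.
pose S : 'M[R]_(m, p + 1) := \matrix_(k, i) ratr (coord e i (vbasis {:V})`_k).
have ST x : x = (x *m S) *m T :> 'rV[R]_m.
  rewrite {1}[x]to_real_basis -mulmxA mulmx_sum_row; apply: eq_bigr => k _.
  congr (_ *: _); rewrite {1}(coord_basis eb (memvf (vbasis {:V})`_k)) to_real_sum.
  rewrite row_mul mulmx_sum_row; apply: eq_bigr => i _.
  by rewrite to_realZ rowK !mxE.
pose d (i : 'I_(p + 1)) : R := ratr (B e`_i e`_i).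
have fE x y : fR x y = \sum_i d i * ((x *m S) 0 i * (y *m S) 0 i).
  rewrite {1}[x]ST {1}[y]ST; move: (x *m S) (y *m S) => X Y.
  rewrite (mulmx_sum_row X) (mulmx_sum_row Y) formR_suml; apply: eq_bigr => i _.
  rewrite formRZl formR_sumr (bigD1 i)//= big1 ?addr0 => [|j ji].
    by rewrite formRZr !rowK formR_to_real -/(d i); ring.
  by rewrite formRZr !rowK formR_to_real eo 1?eq_sym// rmorph0 mulr0.
pose i0 : 'I_(p + 1) := rshift p ord0.
have i0P (i : 'I_(p + 1)) : i != i0 -> (i < p)%N.
  move=> ii0; rewrite ltnNge; apply: contra ii0 => pi.
  apply/eqP/val_inj => /=; apply/eqP; rewrite addn0 eqn_leq pi andbT.
  by rewrite -ltnS -[X in (_ < X)%N]addn1 ltn_ord.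
have d_gt0 i : i != i0 -> 0 < d i.
  by move=> /i0P /epos; rewrite /d ltr0q.
have d0_lt0 : d i0 < 0 by rewrite /d ltrq0 eneg//= leq_addr.
pose v := uR + uR'.
have fv : fR v v = -1.
  by rewrite !formRDl !formRDr formR_uu formR_u'u' formR_uu' formR_u'u; lra.
pose y := v *m S.
(* The negative part of (v, v) = -1, so k = 1 + Vv exceeds the positive part [Vv]. This gap is what
   leaves (w, w) at least Ww / k after Cauchy-Schwarz. *)
pose k := - d i0 * y 0 i0 ^+ 2.
have [C C0 HC] := nrm2_mulmx T.
pose mn := \sum_i `|d i|^-1.
(* [C] accounts for the change of basis, [mn] for removing the weights |d_i|, and 2k for comparing
   Ww plus the absolute value of the negative part with (w, w). *)
exists (C * mn * (2 * k)).
all: have fvE := fv; rewrite fE (bigD1 i0)//= in fvE.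
all: set Vv := \sum_(i | i != i0) d i * _ in fvE.
all: have Vv0 : 0 <= Vv by apply: sumr_ge0 => i /d_gt0 /ltW di; rewrite mulr_ge0// -expr2 sqr_ge0.
all: have k1 : k = 1 + Vv by rewrite /k -/y; move: fvE; rewrite -/y; lra.
all: have k_gt0 : 0 < k by lra.
  apply: mulr_gt0; last by rewrite mulr_gt0.
  apply: mulr_gt0 => //; rewrite /mn (bigD1 i0)//=; apply: ltr_wpDr.
    by apply: sumr_ge0 => i _; rewrite invr_ge0.
  by rewrite invr_gt0 normr_gt0 lt_eqF.
move=> w [wu wu'].
pose z := w *m S.
have Q0 : fR w v = 0 by rewrite formRDr wu wu' addr0.
pose Ww := \sum_(i | i != i0) d i * z 0 i ^+ 2.
have Ww0 : 0 <= Ww by apply: sumr_ge0 => i /d_gt0 /ltW di; rewrite mulr_ge0// sqr_ge0.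
have VvE : Vv = \sum_(i | i != i0) d i * y 0 i ^+ 2.
  by apply: eq_bigr => i _; rewrite expr2.
have := @cauchy_schwarz R 'I_(p + 1) (fun i => i != i0) d (z 0) (y 0) (fun i h => ltW (d_gt0 i h)).
rewrite -/Ww -VvE.
have -> : \sum_(i | i != i0) d i * (z 0 i * y 0 i) = - (d i0 * (z 0 i0 * y 0 i0)).
  by apply/eqP; rewrite -addr_eq0 addrC -[X in _ == X]Q0 fE [X in _ == X](bigD1 i0).
move=> CS.
have Qw : fR w w = Ww + d i0 * z 0 i0 ^+ 2.
  rewrite fE (bigD1 i0)//= addrC; congr (_ + _).
have key : (- d i0 * z 0 i0 ^+ 2) * k <= Ww * Vv.
  apply: le_trans CS; rewrite /k le_eqVlt; apply/orP; left; apply/eqP; ring.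
have D0 : 0 <= - d i0 * z 0 i0 ^+ 2 by rewrite mulr_ge0 ?sqr_ge0// oppr_ge0 ltW.
have h2 : Ww + (- d i0 * z 0 i0 ^+ 2) <= 2 * k * fR w w.
  rewrite Qw; move: key D0; rewrite !mulNr; set D := d i0 * z 0 i0 ^+ 2 => key D0.
  have hk : Vv = k - 1 by lra.
  rewrite hk in key; nra.
rewrite {1}[w]ST; apply: (le_trans (HC _)).
apply: (@le_trans _ _ (C * (mn * (2 * k * fR w w)))); last by rewrite !mulrA.
rewrite ler_wpM2l ?(ltW C0)//.
have mn0 : 0 <= mn by apply: sumr_ge0 => i _; rewrite invr_ge0.
have absE : \sum_i `|d i| * z 0 i ^+ 2 = Ww + (- d i0 * z 0 i0 ^+ 2).
  rewrite (bigD1 i0)//= addrC ltr0_norm//; congr (_ + _).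
  by apply: eq_bigr => i /d_gt0 di; rewrite gtr0_norm.
apply: (@le_trans _ _ (mn * \sum_i `|d i| * z 0 i ^+ 2)); last first.
  by rewrite absE ler_wpM2l.
rewrite /nrm2 mulr_sumr; apply: ler_sum => i _.
have di : 0 < `|d i|.
  rewrite normr_gt0; have [->|/d_gt0 h] := eqVneq i i0; first by rewrite lt_eqF.
  by rewrite gt_eqF.
apply: (@le_trans _ _ (`|d i|^-1 * (`|d i| * z 0 i ^+ 2))).
  by rewrite mulrA mulVf ?gt_eqF// mul1r.
apply: ler_wpM2r; first by rewrite mulr_ge0// sqr_ge0.
by rewrite /mn (bigD1 i)//= lerDl; apply: sumr_ge0 => j _; rewrite invr_ge0.
Qed.

Local Notation y1 := (@y1coord R V B u').
Local Notation ym := (@ymcoord R V B u).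
Local Notation wp := (@wpart R V B u u').

Lemma y1coord_comb (y z : R) w : W w -> y1 (y *: uR + w + z *: uR') = y.
Proof.
move=> [wu wu'].
by rewrite /y1coord !formRDl !formRZl formR_uu' formR_u'u' wu'; lra.
Qed.

Lemma ymcoord_comb (y z : R) w : W w -> ym (y *: uR + w + z *: uR') = z.
Proof.
move=> [wu wu'].
by rewrite /ymcoord !formRDl !formRZl formR_uu formR_u'u wu; lra.
Qed.

Lemma wpart_comb (y z : R) w : W w -> wp (y *: uR + w + z *: uR') = w.
Proof.
move=> Ww; rewrite /wpart y1coord_comb// ymcoord_comb//.
by apply/rowP => i; rewrite !mxE; ring.
Qed.

Lemma Wreal_wpart x : W (wp x).
Proof.
split; rewrite /wpart !formRDl !formRNl !formRZl ?formR_uu ?formR_u'u ?formR_uu' ?formR_u'u'.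
  by rewrite /ymcoord; lra.
by rewrite /y1coord; lra.
Qed.

Lemma realpts_decomp x : x = y1 x *: uR + wp x + ym x *: uR'.
Proof.
rewrite /wpart; set a := y1 x; set b := ym x.
by apply/rowP => i; rewrite !mxE; ring.
Qed.

Lemma WrealD x y : W x -> W y -> W (x + y).
Proof. by move=> [a b] [c d]; split; rewrite formRDl ?a ?b ?c ?d addr0. Qed.

Lemma WrealZ c x : W x -> W (c *: x).
Proof. by move=> [a b]; split; rewrite formRZl ?a ?b mulr0. Qed.

Lemma WrealN x : W x -> W (- x).
Proof. by rewrite -scaleN1r; exact: WrealZ. Qed.

Lemma y1coordP c x y : y1 (c *: x + y) = c * y1 x + y1 y.
Proof. by rewrite /y1coord formRDl formRZl; ring. Qed.

Lemma ymcoordP c x y : ym (c *: x + y) = c * ym x + ym y.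
Proof. by rewrite /ymcoord formRDl formRZl; ring. Qed.

Lemma wpartP c x y : wp (c *: x + y) = c *: wp x + wp y.
Proof.
rewrite /wpart y1coordP ymcoordP !scalerDl -!scalerA !scalerBr.
by apply/rowP => i; rewrite !mxE; ring.
Qed.

Lemma Wform_ge0 w : W w -> 0 <= fR w w.
Proof.
move=> Ww; have [c c0 H] := Wreal_posdef.
by rewrite -(pmulr_rge0 _ c0); apply: le_trans (H _ Ww); exact: nrm2_ge0.
Qed.

Lemma Wform_add w w' : W w -> W w' ->
  fR (w + w') (w + w') <= 2 * fR w w + 2 * fR w' w'.
Proof.
move=> Ww Ww'; have := Wform_ge0 (WrealD Ww (WrealN Ww')).
by rewrite !formRDl !formRDr !formRNl !formRNr (formRC w' w); lra.
Qed.

End RealForm.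

(** * The isometries a(t) and n(b) in coordinates *)

Section Isometries.
Context (R : realType) (V : vectType rat) (B : {symmetric V}) (u u' : V).
Hypotheses (isou : B u u = 0) (isou' : B u' u' = 0) (uu' : B u u' = - 2^-1).
Local Notation m := (\dim {:V}).
Local Notation fR := (@formR R V B).
Local Notation tR := (@to_real R V).
Local Notation uR := (tR u).
Local Notation uR' := (tR u').
Local Notation W := (@Wreal R V B u u').
Local Notation y1 := (@y1coord R V B u').
Local Notation ym := (@ymcoord R V B u).
Local Notation wp := (@wpart R V B u u').

Lemma mulmx_lin1_mx k (f : 'rV[R]_k -> 'rV[R]_k) :
  (forall c x y, f (c *: x + y) = c *: f x + f y) ->
  forall x, x *m lin1_mx f = f x.
Proof.
move=> lf x; have f0 : f 0 = 0.
  by have := lf (-1) 0 0; rewrite scaler0 addr0 scaleN1r addNr.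
have fs (r : seq 'I_k) (c : 'I_k -> R) (F : 'I_k -> 'rV[R]_k) :
    f (\sum_(i <- r) c i *: F i) = \sum_(i <- r) c i *: f (F i).
  elim: r => [|i r IH]; first by rewrite !big_nil f0.
  by rewrite !big_cons lf IH.
rewrite [in RHS](row_sum_delta x) fs mulmx_sum_row; apply: eq_bigr => i _.
by congr (_ *: _); apply/rowP => j; rewrite !mxE.
Qed.

Lemma a_isomP (t c : R) (x y : realpts R V) :
  a_isom B u u' t (c *: x + y) = c *: a_isom B u u' t x + a_isom B u u' t y.
Proof.
rewrite /a_isom y1coordP ymcoordP wpartP.
move: (y1 x) (y1 y) (ym x) (ym y) (wp x) (wp y) => a b e g w w'.
by apply/rowP => i; rewrite !mxE; ring.
Qed.

Lemma n_isomP (b : realpts R V) (c : R) (x y : realpts R V) :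
  n_isom B u u' b (c *: x + y) = c *: n_isom B u u' b x + n_isom B u u' b y.
Proof.
rewrite /n_isom y1coordP ymcoordP wpartP formRDl formRZl.
move: (fR (wp x) b) (fR (wp y) b) (fR b b) => f1 f2 f3.
move: (y1 x) (y1 y) (ym x) (ym y) (wp x) (wp y) => a a' e g w w'.
by apply/rowP => i; rewrite !mxE; ring.
Qed.

Lemma n_isomE b x : n_isom B u u' b x =
  (y1 x + 2 * fR (wp x) b + ym x * fR b b) *: uR + (wp x + ym x *: b) + ym x *: uR'.
Proof.
rewrite /n_isom.
move: (fR (wp x) b) (fR b b) (y1 x) (ym x) (wp x) => f1 f3 a e w.
by apply/rowP => i; rewrite !mxE; ring.
Qed.

Lemma a_isomK (t : R) : t != 0 -> cancel (a_isom B u u' t) (a_isom B u u' t^-1).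
Proof.
move=> t0 x; rewrite {1}/a_isom /a_isom.
have Ww := Wreal_wpart isou isou' uu' x.
rewrite (y1coord_comb isou' uu')// (ymcoord_comb isou uu')// (wpart_comb isou isou' uu')//.
rewrite invrK !mulrA mulVf// mulfV// !mul1r.
by rewrite -realpts_decomp.
Qed.

Lemma n_isomK b : W b -> cancel (n_isom B u u' b) (n_isom B u u' (- b)).
Proof.
move=> Wb x; rewrite [n_isom _ _ _ b x]n_isomE n_isomE.
have Ww := Wreal_wpart isou isou' uu' x.
have Ww' : W (wp x + ym x *: b) by apply: WrealD => //; exact: WrealZ.
rewrite (y1coord_comb isou' uu')// (ymcoord_comb isou uu')// (wpart_comb isou isou' uu')//.
rewrite !formRNr formRNl !formRDl formRZl opprK.
rewrite [RHS](realpts_decomp B u u' x).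
move: (fR (wp x) b) (fR b b) (y1 x) (ym x) (wp x) => f1 f3 a e w.
by apply/rowP => i; rewrite !mxE; ring.
Qed.

Lemma lin1_mx_cancel k (f g : 'rV[R]_k -> 'rV[R]_k) :
  (forall c x y, f (c *: x + y) = c *: f x + f y) ->
  (forall c x y, g (c *: x + y) = c *: g x + g y) ->
  cancel f g -> lin1_mx f \in unitmx /\ invmx (lin1_mx f) = lin1_mx g.
Proof.
move=> lf lg fg.
have E : lin1_mx f *m lin1_mx g = 1%:M.
  by apply/row_matrixP => i; rewrite !rowE mulmxA !mulmx_lin1_mx// fg mulmx1.
have [fu _] := mulmx1_unit E.
by split=> //; rewrite -[RHS](mulKmx fu) E mulmx1.
Qed.

Lemma n_mx_inv (b : realpts R V) : W b -> n_mx B u u' b \in unitmx /\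
  invmx (n_mx B u u' b) = n_mx B u u' (- b).
Proof. by move=> Wb; exact: (lin1_mx_cancel (n_isomP b) (n_isomP (- b)) (n_isomK Wb)). Qed.

Lemma a_mx_inv (t : R) : t != 0 -> a_mx B u u' t \in unitmx /\
  invmx (a_mx B u u' t) = a_mx B u u' t^-1.
Proof. by move=> t0; exact: (lin1_mx_cancel (a_isomP t) (a_isomP t^-1) (a_isomK t0)). Qed.

(** The factors t^-1 on y_1 and t on y_m are the source of the fine grid and of the decay for y_m <>
    0. The element n(b) enters y_1 only through a translation depending on w and y_m. *)
Lemma row_moved n (X : realpts_pow R V n) (t : R) (b : realpts R V) j : t != 0 -> W b ->
  row j (X *m invmx (n_mx B u u' b) *m invmx (a_mx B u u' t)) =
  (t^-1 * (y1 (row j X) - 2 * fR (wp (row j X)) b + ym (row j X) * fR b b)) *: uR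
  + (wp (row j X) - ym (row j X) *: b) + (t * ym (row j X)) *: uR'.
Proof.
move=> t0 Wb; rewrite (n_mx_inv Wb).2 (a_mx_inv t0).2 /n_mx /a_mx.
rewrite !row_mul (mulmx_lin1_mx (n_isomP (- b))) (mulmx_lin1_mx (a_isomP t^-1)).
set x := row j X; rewrite n_isomE /a_isom.
have Ww := Wreal_wpart isou isou' uu' x.
have Ww' : W (wp x + ym x *: - b) by apply: WrealD => //; apply: WrealZ; exact: WrealN.
rewrite (y1coord_comb isou' uu')// (ymcoord_comb isou uu')// (wpart_comb isou isou' uu')//.
by rewrite !formRNr formRNl opprK invrK scalerN mulrN.
Qed.

Lemma siegel_point t b : W b -> n_isom B u u' b (a_isom B u u' t (uR + uR')) =
  (t + t^-1 * fR b b) *: uR + (t^-1 *: b) + t^-1 *: uR'.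
Proof.
move=> Wb; have W0 : W 0 by split; rewrite formR0l.
have E : uR + uR' = 1 *: uR + 0 + 1 *: uR' by rewrite !scale1r addr0.
rewrite /a_isom E (y1coord_comb isou' uu')// (ymcoord_comb isou uu')// (wpart_comb isou isou' uu')//.
rewrite n_isomE (y1coord_comb isou' uu')// (ymcoord_comb isou uu')// (wpart_comb isou isou' uu')//.
by rewrite formR0l !mulr1 mulr0 addr0 add0r.
Qed.

(** The parameters can be read off the point: its u'-coordinate is t^-1 and its W-part is t^-1 b. *)
Lemma siegel_coords (Omega : set (realpts R V)) t0 t b : 0 < t -> W b ->
  Omega `<=` W -> 0 < t0 ->
  siegel_set B u u' Omega t0 (n_isom B u u' b (a_isom B u u' t (uR + uR'))) ->
  t0 < t /\ Omega b.
Proof.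
move=> t_gt0 Wb OW t00 [[t' b'] /= [tt' Ob'] E].
have Wb' := OW _ Ob'.
rewrite !siegel_point// in E.
have Wtb : W (t^-1 *: b) by exact: WrealZ.
have Wtb' : W (t'^-1 *: b') by exact: WrealZ.
have /(f_equal ym) := E; rewrite !(ymcoord_comb isou uu')// => /invr_inj tE.
have /(f_equal wp) := E; rewrite !(wpart_comb isou isou' uu')// => /eqP.
rewrite tE -subr_eq0 -scalerBr scaler_eq0 invr_eq0 gt_eqF//= subr_eq0 => /eqP <-.
by rewrite -tE.
Qed.

Lemma rel_compact_form_bound (Omega : set (realpts R V)) :
  rel_compact_open_in_W B u u' Omega ->
  (Omega `<=` W) /\ exists2 K : R, 0 < K & forall b, Omega b -> fR b b <= K.
Proof.
move=> [[U _ OE] cO]; split; first by rewrite OE => x [].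
have ci i : exists K : R, forall b, Omega b -> b 0 i ^+ 2 <= K.
  have : compact ((fun b : realpts R V => b 0 i) @` closure Omega).
    apply: continuous_compact => //.
    apply: continuous_subspaceT => x; exact: coord_continuous.
  move=> /compact_bounded[K [_ /(_ (K + 1))]]; rewrite ltrDl ltr01 => /(_ isT) HK.
  exists ((K + 1) ^+ 2) => b Ob.
  have bK : `|b 0 i| <= K + 1 by apply: HK; exists b => //; exact: subset_closure.
  by rewrite -(real_normK (num_real (b 0 i))) lerXn2r ?nnegrE// (le_trans _ bK).
have /choice[K HK] := ci.
have [C C0 HC] := nrm2_mulmx (gramR R B).
have hn b : Omega b -> nrm2 b <= \sum_i `|K i|.
  move=> Ob; apply: ler_sum => i _; apply: (le_trans (HK i b Ob)); exact: ler_norm.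
exists ((C + 1) * (1 + \sum_i `|K i|)).
  by apply: mulr_gt0; [lra|rewrite ltr_wpDr// sumr_ge0].
move=> b Ob; apply: (@le_trans _ _ ((C + 1) * nrm2 b)); last first.
  by apply: ler_wpM2l; [lra|apply: (le_trans (hn b Ob)); rewrite lerDr].
apply: (@le_trans _ _ (nrm2 (b *m gramR R B) + nrm2 b)).
  rewrite /formR mxE /nrm2 -big_split/=; apply: ler_sum => i _.
  rewrite [b^T i 0]mxE.
  have := sqr_ge0 ((b *m gramR R B) 0 i - b 0 i); nra.
by rewrite mulrDl mul1r lerD2r.
Qed.

End Isometries.

(** * Lattices *)

Section FiniteSums.
Context (R : realType).

Lemma sum_uniq_sub (T : eqType) (s r : seq T) (F : T -> R) :
  uniq s -> uniq r -> {subset s <= r} -> (forall x, 0 <= F x) ->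
  \sum_(x <- s) F x <= \sum_(x <- r) F x.
Proof.
move=> us ur sr F0; pose r' := [seq x <- r | x \in s].
have pr : perm_eq s r'.
  apply: uniq_perm => //; first exact: filter_uniq.
  move=> x; rewrite mem_filter; case xs: (x \in s) => //=.
  by rewrite sr.
rewrite (perm_big _ pr) /r' big_filter [leRHS](bigID (mem s))/= lerDl.
by apply: sumr_ge0.
Qed.

(** Any finite family lies in a box, and over a box the sum of products is a product of sums. *)
Lemma sum_int_box (K : finType) (h : int -> R) (H : R) :
  (forall z, 0 <= h z) ->
  (forall M : nat, \sum_(i < M.*2.+1) h (i%:Z - M%:Z) <= H) ->
  forall G : seq {ffun K -> int}, uniq G ->
  \sum_(z <- G) \prod_k h (z k) <= H ^+ #|K|.
Proof.
move=> h0 hH G uG.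
have [M HM] : exists M : nat, forall z, z \in G -> forall k, (`|z k| <= M)%N.
  elim: G {uG} => [|z G [M HM]]; first by exists 0%N.
  exists (maxn M (\max_k `|z k|%N)) => z'; rewrite inE => /orP[/eqP ->|/HM h'] k.
    by rewrite leq_max (leq_bigmax k) orbT.
  by rewrite leq_max h'.
pose psi (i : {ffun K -> 'I_M.*2.+1}) : {ffun K -> int} := [ffun k => (i k)%:Z - M%:Z].
have psi_inj : injective psi.
  move=> i j /ffunP E; apply/ffunP => k; have := E k; rewrite !ffunE => /addIr [E'].
  exact: val_inj.
apply: (@le_trans _ _ (\sum_(z <- [seq psi i | i <- index_enum _]) \prod_k h (z k))).
  apply: sum_uniq_sub => //.
  - by rewrite map_inj_uniq// index_enum_uniq.
  - move=> z zG; apply/mapP.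
    exists [ffun k => inord `|(z k + M%:Z)%R|%N]; first by rewrite mem_index_enum.
    apply/ffunP => k; rewrite !ffunE.
    have zk := HM z zG k.
    have zM : 0 <= z k + M%:Z by lia.
    rewrite inordK; first by rewrite gez0_abs// addrK.
    by lia.
  - by move=> z; apply: prodr_ge0.
rewrite big_map; under eq_bigr => i _ do under eq_bigr => k _ do rewrite ffunE.
rewrite -(bigA_distr_bigA (fun (k : K) (j : 'I_M.*2.+1) => h (j%:Z - M%:Z)))/=.
rewrite -prodr_const; apply: ler_prod => k _.
by rewrite sumr_ge0//= hH.
Qed.

Lemma sum_gauss_box (d : R) : 0 < d -> exists2 H : R, 0 < H & forall M : nat,
  \sum_(i < M.*2.+1) expR (- (d * (i%:Z - M%:Z)%:~R ^+ 2)) <= H.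
Proof.
move=> d0; have h : 0 < (2^-1 : R) by lra.
(* The bound requires t0 < t strictly; it is applied at t = 1 with t0 = 1/2. *)
have [C C0 HC] := @box_sum_bound R 1 2^-1 ltr01 h.
have K0 := gauss_cst_gt0 d0.
exists (gauss_cst d * C); first exact: mulr_gt0.
have gK (x : R) : `|gaussd d 0 x| <= gauss_cst d * (1 + x ^+ 2)^-1.
  by have := gaussd_bound d0 0 x; rewrite fact0 mul1r.
move=> M; have h1 : (2^-1 : R) < 1 by lra.
have := HC _ _ (ltW K0) gK 1 0 M h1; rewrite mulr1; apply: le_trans.
rewrite /box_sum; apply: ler_sum => i _.
rewrite gaussd0 ger0_norm ?expR_ge0// ler_expR lerN2.
by rewrite divr1 addr0 mul1r rmorphB/= !pmulrn.
Qed.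

End FiniteSums.

Section Lattice.
Context (R : realType) (V : vectType rat) (B : {symmetric V}) (u u' : V) (L : set V).
Hypotheses (isou' : B u' u' = 0) (uu' : B u u' = - 2^-1) (latL : is_lattice L)
  (integralL : L `<=` dual_lattice B L) (splitL : lattice_splits B u u' L).
Local Notation tR := (@to_real R V).

Lemma latticeD x y : L x -> L y -> L (x + y).
Proof.
have [e [eb ->]] := latL => -[a ->] [b ->]; exists (a + b).
by rewrite -big_split/=; apply: eq_bigr => i _; rewrite ffunE mulrzDr.
Qed.

Lemma latticeN x : L x -> L (- x).
Proof.
have [e [eb ->]] := latL => -[a ->]; exists (- a).
by rewrite -sumrN; apply: eq_bigr => i _; rewrite ffunE mulrNz.
Qed.

Lemma latticeB x y : L x -> L y -> L (x - y).
Proof. by move=> Lx Ly; apply: latticeD => //; exact: latticeN. Qed.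

Lemma latticeMz x (k : int) : L x -> L (k%:~R *: x).
Proof.
have [e [eb ->]] := latL => -[a ->]; exists [ffun i => a i * k].
rewrite scaler_sumr; apply: eq_bigr => i _; rewrite ffunE mulrzA.
by rewrite scaler_int.
Qed.

Lemma lattice_multiple v : exists2 N : nat, (0 < N)%N & L (N%:R *: v).
Proof.
have [e [eb LE]] := latL.
pose q i := coord e i v.
pose N := (\prod_i `|denq (q i)|)%N.
exists N; first by apply: prodn_gt0 => i; rewrite absz_gt0 denq_neq0.
rewrite LE /=; exists [ffun i => numq (q i) * (\prod_(j | j != i) `|denq (q j)|)%N%:Z].
rewrite {1}(coord_basis eb (memvf v)) scaler_sumr; apply: eq_bigr => i _.
rewrite ffunE scalerA -scaler_int; congr (_ *: _).
rewrite /N (bigD1 i)//= natrM rmorphM/= -/(q i).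
have hd : `|denq (q i)|%N%:R = (denq (q i))%:~R :> rat.
  by rewrite -[in RHS](gtz0_abs (denq_gt0 (q i))).
by rewrite hd mulrAC [_%:~R * q i]mulrC -numqE.
Qed.

(** Some N u' lies in L, and pairing c u with it gives the integer - c N / 2; hence every c is a
    multiple of 2 / N. The least positive multiple that occurs generates, by division with
    remainder. *)
Lemma lattice_generator : exists al : rat, [/\ 0 < al, L (al *: u) &
  forall c, L (c *: u) -> exists k : int, c = k%:~R * al].
Proof.
have [N N0 LN] := lattice_multiple u'.
have [N' N0' LN'] := lattice_multiple u.
have int_c c : L (c *: u) -> exists k : int, c = k%:~R * (2 / N%:R).
  move=> Lc; have := integralL Lc LN.
  rewrite linearZr/= linearZl_LR/= uu' => /intrP[k hk].
  exists (- k); rewrite rmorphN/= -hk; field.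
  by rewrite pnatr_eq0 -lt0n.
have exP : exists k : nat, (0 < k)%N && `[< L ((k%:R * (2 / N%:R)) *: u) >].
  have [k hk] := int_c _ LN'.
  have k0 : 0 < k.
    have h : 0 < N'%:R :> rat by rewrite ltr0n.
    have h2 : 0 < (2 / N%:R : rat) by rewrite divr_gt0 ?ltr0n.
    by move: h; rewrite hk pmulr_lgt0// ltr0z.
  exists `|k|%N; rewrite absz_gt0 gt_eqF//=; apply/asboolP.
  by rewrite -[_%:R]/(`|k|%N%:Z%:~R) gtz0_abs// -hk.
case: (ex_minnP exP) => k /andP[k0 /asboolP Lk] kmin.
exists (k%:R * (2 / N%:R)); split => //.
  by rewrite mulr_gt0 ?divr_gt0 ?ltr0n.
move=> c Lc; have [z hz] := int_c c Lc.
exists (z %/ k%:Z)%Z.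
have zE := divz_eq z k%:Z.
have k0' : k%:Z != 0 by rewrite gt_eqF.
have r0 := modz_ge0 z k0'.
have rk : (z %% k%:Z)%Z < k%:Z by rewrite ltz_pmod.
have [rz|rz] := eqVneq (z %% k%:Z)%Z 0.
  have zE' : z%:~R = (z %/ k%:Z)%Z%:~R * k%:R :> rat.
    by rewrite -[k%:R]/(k%:Z%:~R) -intrM {1}zE rz addr0.
  by rewrite hz zE' -mulrA.
have Lr : L (((z %% k%:Z)%Z%:~R * (2 / N%:R)) *: u).
  have -> : (z %% k%:Z)%Z%:~R * (2 / N%:R) = c - (z %/ k%:Z)%Z%:~R * (k%:R * (2 / N%:R)).
    have zE' : z%:~R = (z %/ k%:Z)%Z%:~R * k%:R + (z %% k%:Z)%Z%:~R :> rat.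
      by rewrite -[k%:R]/(k%:Z%:~R) -intrM -intrD -zE.
    by rewrite hz zE'; ring.
  by rewrite scalerBl; apply: latticeB => //; rewrite -scalerA; exact: latticeMz.
have := kmin `|(z %% k%:Z)%Z|%N.
rewrite absz_gt0 rz/= -[X in X * _]/(`|(z %% k%:Z)%Z|%N%:Z%:~R) gez0_abs//.
move=> /(_ (introT (asboolP _) Lr)) h.
by move: rk; rewrite -(gez0_abs r0) ltNge lez_nat h.
Qed.

Lemma lattice_decomp (al : rat) x :
  (forall c, L (c *: u) -> exists k : int, c = k%:~R * al) -> L x ->
  exists k : int, exists x', [/\ L x', B x' u' = 0 & x = (k%:~R * al) *: u + x'].
Proof.
move=> gen Lx; move: (Lx); rewrite {1}splitL => -[a [b [c [[La au] [Lb bW] [Lc cu'] xE]]]].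
have /vlineP[ca caE] := au; have /vlineP[cc ccE] := cu'.
rewrite caE in La; have [k hk] := gen _ La.
exists k, (b + c); split; first exact: latticeD.
  rewrite linearDl/= ccE linearZl_LR/= isou' mulr0 addr0.
  move/mem_orthovP: bW; apply; rewrite memv_span// !inE eqxx orbT//.
by rewrite xE caE hk addrA.
Qed.

Lemma lattice_decomp_uniq (al : rat) (k k' : int) x x' : 0 < al ->
  B x u' = 0 -> B x' u' = 0 ->
  (k%:~R * al) *: u + x = (k'%:~R * al) *: u + x' -> k = k' /\ x = x'.
Proof.
move=> al0 Bx Bx' E.
have /(f_equal (fun z => B z u')) := E.
rewrite !linearDl/= !linearZl_LR/= uu' Bx Bx' !addr0 /GRing.scale/= => kk.
have kE : k = k'.
  apply/eqP; rewrite -(eqr_int rat); apply/eqP.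
  have h : al * - 2^-1 != 0 by rewrite lt_eqF// mulrN oppr_lt0 divr_gt0.
  exact: (mulIf h).
split => //; move: E; rewrite kE; exact: addrI.
Qed.

(** The pairing of x with al u is an integer and y_m = - 2 (x, u), so y_m is an integral multiple of
    2 / al. *)
Lemma dual_ymcoord_discrete (al : rat) x : 0 < al -> L (al *: u) ->
  dual_lattice B L x -> ymcoord B u (tR x) != 0 ->
  (2 * ratr al^-1 : R) <= `|ymcoord B u (tR x)|.
Proof.
move=> al0 Lal dx.
rewrite /ymcoord formR_to_real; have := dx _ Lal; rewrite linearZr/= => /intrP[k hk].
have -> : B x u = k%:~R * al^-1.
  by rewrite -hk mulrAC mulfV ?mul1r ?gt_eqF.
move=> nz; rewrite normrM normrN (ger0_norm (ler0n _ 2)) ler_wpM2l// rmorphM/= normrM.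
have a0 : 0 < ratr al^-1 :> R by rewrite ltr0q invr_gt0.
rewrite (gtr0_norm a0) ler_peMl ?(ltW a0)//.
rewrite ratr_int -intr_norm -[1]/(1%:~R) ler_int.
have k0 : k != 0.
  by apply: contra nz => /eqP ->; rewrite rmorphM/= rmorph0 mul0r mulr0.
by move: k0; lia.
Qed.

(** In a basis of L the points have integer coordinates, and a linear change of basis bounds the
    squares of these coordinates by a multiple of [nrm2]. The sum is thus dominated by a power of a
    one-dimensional Gaussian sum over the integers. *)
Lemma lattice_gauss_sum n (d : R) : 0 < d -> exists2 C : R, 0 < C &
  forall F : seq {ffun 'I_n -> V}, uniq F -> (forall X, X \in F -> forall j, L (X j)) ->
  \sum_(X <- F) expR (- (d * \sum_j nrm2 (tR (X j)))) <= C.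
Proof.
move=> d0; have [e [eb LE]] := latL.
pose S : 'M[R]_(\dim {:V}, \dim {:V}) := \matrix_(k, i) ratr (coord e i (vbasis {:V})`_k).
have [C0 C00 HC0] := nrm2_mulmx S.
have SE v i : (tR v *m S) 0 i = ratr (coord e i v).
  rewrite mxE {2}(coord_vbasis (memvf v)) linear_sum rmorph_sum/=.
  by apply: eq_bigr => k _; rewrite !mxE linearZ/= rmorphM.
have dC0 : 0 < d / C0 by rewrite divr_gt0.
have [H H0 HH] := sum_gauss_box dC0.
exists (H ^+ #|{: 'I_n * 'I_(\dim {:V})}|); first exact: exprn_gt0.
move=> F uF LF.
(* The floor merely makes the coordinates integers by type; on members of [F] it changes nothing
   ([zcE]). *)
pose zc (X : {ffun 'I_n -> V}) : {ffun 'I_n * 'I_(\dim {:V}) -> int} :=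
  [ffun ji => Num.floor (coord e ji.2 (X ji.1))].
have zcE X : X \in F -> forall j i, coord e i (X j) = (zc X (j, i))%:~R.
  move=> XF j i; rewrite ffunE/=.
  have : L (X j) by exact: LF.
  rewrite LE => -[a ->].
  rewrite linear_sum/= (bigD1 i)//= big1 => [|k ki].
    rewrite addr0 raddfMz/= coord_free ?(basis_free eb)// eqxx.
    by rewrite intrKfloor.
  by rewrite raddfMz/= coord_free ?(basis_free eb)// (negPf ki) mul0rz.
have zc_inj : {in F &, injective zc}.
  move=> X Y XF YF E; apply/ffunP => j.
  rewrite (coord_basis eb (memvf (X j))) (coord_basis eb (memvf (Y j))).
  by apply: eq_bigr => i _; rewrite !zcE// E.
pose h (z : int) : R := expR (- (d / C0 * z%:~R ^+ 2)).
apply: (@le_trans _ _ (\sum_(z <- [seq zc X | X <- F]) \prod_ji h (z ji))); last first.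
  apply: sum_int_box => //; first by move=> z; exact: expR_ge0.
  by rewrite map_inj_in_uniq.
rewrite big_map big_seq [leRHS]big_seq; apply: ler_sum => X XF.
rewrite /h -expR_sum ler_expR sumrN lerN2 -mulr_sumr.
rewrite mulrAC ler_pdivrMr// -mulrA ler_wpM2l ?(ltW d0)//.
have -> : \sum_ji (zc X ji)%:~R ^+ 2 = \sum_j \sum_i (zc X (j, i))%:~R ^+ 2 :> R.
  by rewrite pair_bigA; apply: eq_bigr => -[].
rewrite mulr_suml.
apply: ler_sum => j _; rewrite [leRHS]mulrC; apply: le_trans (HC0 _).
by apply: ler_sum => i _; rewrite SE zcE// ratr_int.
Qed.

End Lattice.

(** * Unconditional sums *)

Section UnconditionalSums.
Context (R : realType) (T : choiceType) (D : set T).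

(** Summability expressed through finite real sums, which keeps extended reals out of the
    estimates. *)
Definition bounded_sums (g : T -> R) (C : R) := forall s : seq T,
  uniq s -> (forall x, x \in s -> D x) -> \sum_(x <- s) `|g x| <= C.

Lemma fsum_seq (A : set T) (g : T -> R) : finite_set A ->
  exists s : seq T, [/\ uniq s, (forall x, x \in s <-> A x) &
    (\sum_(x \in A) (g x)%:E = (\sum_(x <- s) g x)%:E)%E].
Proof.
move=> /finite_seqP[s ->]; exists (undup s); split; first exact: undup_uniq.
  by move=> x; rewrite mem_undup.
rewrite (_ : [set` s] = [set` undup s])%classic.
  by rewrite -fsbig_seq ?undup_uniq// sumEFin.
by apply/seteqP; split => x /=; rewrite mem_undup.
Qed.

Lemma bounded_sums_esum (g : T -> R) (C : R) : bounded_sums g C ->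
  (\esum_(x in D) `|(g x)%:E| <= C%:E)%E.
Proof.
move=> gC; apply: ge_ereal_sup => _ [A [fA AD] <-].
have [s [us sA E]] := fsum_seq (fun x => `|g x|) fA.
rewrite [leLHS](_ : _ = \sum_(x \in A) (`|g x|)%:E)%E//.
by rewrite E lee_fin; apply: gC => // x /sA/AD.
Qed.

Lemma esum_approx (g : T -> R) (C : R) : (forall x, 0 <= g x) ->
  bounded_sums g C -> forall e : R, 0 < e ->
  exists s0 : seq T, (forall x, x \in s0 -> D x) /\
  forall s : seq T, uniq s -> (forall x, x \in s -> D x) -> {subset s0 <= s} ->
   \sum_(x <- s) g x <= fine (\esum_(x in D) (g x)%:E) <= \sum_(x <- s) g x + e.
Proof.
move=> g0 gC e e0; set E := (\esum_(x in D) (g x)%:E)%E.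
have Efin : E \is a fin_num.
  rewrite ge0_fin_numE; last by apply: esum_ge0 => x _; rewrite lee_fin.
  apply: le_lt_trans (ltry C); apply: le_trans (bounded_sums_esum gC).
  by apply: le_esum => x _; rewrite lee_fin ler_norm.
have [A [fA AD] hA] : exists2 A, fsets D A & (E - e%:E < \sum_(x \in A) (g x)%:E)%E.
  have [_ [A hA <-] h] := ub_ereal_sup_adherent e0 Efin.
  by exists A.
have [s0 [us0 s0A sE]] := fsum_seq g fA.
exists s0; split; first by move=> x /s0A/AD.
move=> s us sD s0s; apply/andP; split.
  rewrite -lee_fin fineK//; apply: ereal_sup_ubound.
  exists [set` s]; first by split => //; exact: finite_seq.
  by rewrite -fsbig_seq// sumEFin.
have h : \sum_(x <- s0) g x <= \sum_(x <- s) g x.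
  by apply: sum_uniq_sub.
move: hA; rewrite sE -(fineK Efin) -EFinB lte_fin; lra.
Qed.

Lemma rsum_approx (f : T -> R) (C : R) : bounded_sums f C ->
  forall e : R, 0 < e -> exists s0 : seq T, (forall x, x \in s0 -> D x) /\
  forall s : seq T, uniq s -> (forall x, x \in s -> D x) -> {subset s0 <= s} ->
   `|rsum D f - \sum_(x <- s) f x| <= e.
Proof.
move=> fC e e0.
have pC : bounded_sums (f^\+) C.
  move=> s us sD; apply: le_trans (fC s us sD); apply: ler_sum => x _.
  by rewrite /funrpos ger0_norm ?le_max ?lexx ?orbT// ge_max ler_norm normr_ge0.
have nC : bounded_sums (f^\-) C.
  move=> s us sD; apply: le_trans (fC s us sD); apply: ler_sum => x _.
  rewrite /funrneg ger0_norm ?le_max ?lexx ?orbT// ge_max normr_ge0 andbT.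
  by rewrite -normrN ler_norm.
have [s1 [s1D H1]] := esum_approx (funrpos_ge0 f) pC e0.
have [s2 [s2D H2]] := esum_approx (funrneg_ge0 f) nC e0.
exists (s1 ++ s2); split; first by move=> x; rewrite mem_cat => /orP[/s1D|/s2D].
move=> s us sD ss.
have /andP[h1 h2] := H1 s us sD (fun x xs => ss x (etrans (mem_cat x s1 s2) (introT orP (or_introl xs)))).
have /andP[h3 h4] := H2 s us sD (fun x xs => ss x (etrans (mem_cat x s1 s2) (introT orP (or_intror xs)))).
rewrite /rsum.
have -> : \sum_(x <- s) f x = \sum_(x <- s) f^\+ x - \sum_(x <- s) f^\- x.
  rewrite -sumrB; apply: eq_bigr => x _; rewrite /funrpos /funrneg.
  by case: (leP 0 (f x)) => fx; [rewrite max_r ?oppr_le0 ?subr0|rewrite max_l ?oppr_ge0 ?(ltW fx)// sub0r opprK].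
by rewrite ler_norml; apply/andP; split; lra.
Qed.

(** A finite set of terms beyond which the sum varies by at most e/2 is enlarged to a union of boxes
    over finitely many fibres. So bounds for large boxes suffice, and no infinite sum along a fibre
    is formed. *)
Lemma rsum_fibered_bound (I : choiceType) (J : set I) (n : nat)
    (Phi : {ffun 'I_n -> int} -> I -> T) (f : T -> R) (C C' : R) (Bd : I -> R) :
  bounded_sums f C ->
  (forall k x, J x -> D (Phi k x)) ->
  (forall X, D X -> exists k x, J x /\ X = Phi k x) ->
  (forall k k' x x', J x -> J x' -> Phi k x = Phi k' x' -> k = k' /\ x = x') ->
  (forall x, J x -> forall e : R, 0 < e -> exists M0, forall M, (M0 <= M)%N ->
    `|\sum_(i : {ffun 'I_n -> 'I_M.*2.+1}) f (Phi [ffun j => (i j)%:Z - M%:Z] x)|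
      <= Bd x + e) ->
  (forall F : seq I, uniq F -> (forall x, x \in F -> J x) -> \sum_(x <- F) Bd x <= C') ->
  `|rsum D f| <= C'.
Proof.
move=> fC PD Psurj Pinj fB BC; apply/ler_addgt0Pr => e e0.
have e20 : 0 < e / 2 by rewrite divr_gt0.
have [s0 [s0D Hs0]] := rsum_approx fC e20.
have [F [M1 [FJ HF]]] : exists (F : seq I) (M1 : nat), (forall x, x \in F -> J x) /\
    forall X, X \in s0 -> exists k x, [/\ x \in F, X = Phi k x & forall j, (`|k j| <= M1)%N].
  elim: s0 s0D {Hs0} => [|X s0 IH] s0D; first by exists [::], 0%N.
  have [F [M1 [FJ HF]]] := IH (fun x xs => s0D x (mem_behead (s := X :: s0) xs)).
  have [k [x [Jx XE]]] := Psurj X (s0D X (mem_head _ _)).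
  exists (x :: F), (maxn M1 (\max_j `|k j|%N)); split.
    by move=> y; rewrite inE => /orP[/eqP -> //|/FJ].
  move=> Y; rewrite inE => /orP[/eqP ->|/HF[k' [x' [x'F YE hk']]]].
    by exists k, x; split => //; [exact: mem_head|move=> j; rewrite leq_max (leq_bigmax j) orbT].
  exists k', x'; split => //; first by rewrite inE x'F orbT.
  by move=> j; rewrite leq_max hk'.
pose F' := undup F.
have uF' : uniq F' by exact: undup_uniq.
have F'J x : x \in F' -> J x by rewrite mem_undup; exact: FJ.
(* The remaining slack is divided among the fibres; the successor avoids a zero denominator when
   there are none. *)
pose e' := e / 2 / (size F').+1%:R.
have e'0 : 0 < e' by rewrite divr_gt0.
have [M2 HM2] : exists M2, forall M, (M2 <= M)%N -> forall x, x \in F' ->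
    `|\sum_(i : {ffun 'I_n -> 'I_M.*2.+1}) f (Phi [ffun j => (i j)%:Z - M%:Z] x)| <= Bd x + e'.
  elim: (F') F'J => [|x s IH] sJ; first by exists 0%N.
  have [M2 HM2] := IH (fun y ys => sJ y (mem_behead (s := x :: s) ys)).
  have [M3 HM3] := fB x (sJ x (mem_head _ _)) e' e'0.
  exists (maxn M2 M3) => M; rewrite geq_max => /andP[h2 h3] y.
  by rewrite inE => /orP[/eqP ->|ys]; [exact: HM3|exact: HM2].
pose M := maxn M1 M2.
pose box (i : {ffun 'I_n -> 'I_M.*2.+1}) : {ffun 'I_n -> int} := [ffun j => (i j)%:Z - M%:Z].
have box_inj : injective box.
  move=> i j /ffunP E; apply/ffunP => k; have := E k; rewrite !ffunE => /addIr [E'].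
  exact: val_inj.
pose s := [seq Phi (box i) x | x <- F', i <- index_enum {ffun 'I_n -> 'I_M.*2.+1}].
have us : uniq s.
  apply: allpairs_uniq => //; first exact: index_enum_uniq.
  move=> [x i] [x' i'] /allpairsP[[a b] /= [aF _ [-> ->]]] /allpairsP[[a' b'] /= [aF' _ [-> ->]]].
  by move=> /(Pinj _ _ _ _ (F'J _ aF) (F'J _ aF')) [/box_inj -> ->].
have sD x : x \in s -> D x.
  by move=> /allpairsP[[a b] /= [aF _ ->]]; apply: PD; exact: F'J.
have s0s : {subset s0 <= s}.
  move=> X /HF[k [x [xF -> hk]]]; apply/allpairsP.
  exists (x, [ffun j => inord `|(k j + M%:Z)%R|%N]); split => /=.
  - by rewrite mem_undup.
  - by rewrite mem_index_enum.
  - congr Phi; apply/ffunP => j; rewrite !ffunE.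
    have kj : (`|k j| <= M)%N by rewrite /M leq_max hk.
    have kM : 0 <= k j + M%:Z by move: kj; clear; lia.
    rewrite inordK; first by rewrite gez0_abs// addrK.
    by move: kj; clear; lia.
have := Hs0 s us sD s0s => h.
have sE : \sum_(x <- s) f x = \sum_(x <- F') \sum_i f (Phi (box i) x).
  by rewrite /s big_allpairs_dep.
have hs : `|\sum_(x <- s) f x| <= C' + e / 2.
  rewrite sE; apply: (le_trans (ler_norm_sum _ _ _)).
  apply: (@le_trans _ _ (\sum_(x <- F') (Bd x + e'))).
    rewrite big_seq [leRHS]big_seq; apply: ler_sum => x xF.
    by apply: HM2 => //; rewrite leq_maxr.
  rewrite big_split/= lerD ?BC// big_const_seq count_predT iter_addr_0.
  rewrite -[_ *+ size F']mulr_natr /e' -[leLHS]mulrA ler_piMr ?(ltW e20)// mulrC ler_pdivrMr//.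
  by rewrite mul1r ler_nat.
have -> : rsum D f = (rsum D f - \sum_(x <- s) f x) + \sum_(x <- s) f x by rewrite subrK.
apply: (le_trans (ler_normD _ _)); lra.
Qed.

End UnconditionalSums.

(** Here y counts towards the exponent too; this form is used for absolute convergence, where the
    full Gaussian is available. *)
Lemma ypoly_joint_tame (R : realType) n (Z : Type) (N : Z -> R)
    (Q : 'rV[R]_n -> Z -> R) : (forall z, 0 <= N z) -> ypoly N Q ->
  tame (fun yz : 'rV[R]_n * Z => N yz.2 + nrm2 yz.1) (fun yz => Q yz.1 yz.2).
Proof.
move=> N0; have N0' (yz : 'rV[R]_n * Z) : 0 <= N yz.2 + nrm2 yz.1.
  by rewrite addr_ge0 ?nrm2_ge0.
elim=> [k a ha|Q1 Q2 _ h1 _ h2]; last exact: tame_add.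
apply: tame_mul.
  move=> d d0; have [C C0 HC] := ha d d0; exists C => // yz.
  apply: (le_trans (HC _)); rewrite ler_wpM2l ?(ltW C0)// ler_expR.
  by rewrite ler_wpM2l ?(ltW d0)// lerDl nrm2_ge0.
apply: tame_prod => // j; apply: tame_exp => //.
apply: (@tame_le R _ _ N0' _ 1) => // yz; rewrite mul1r.
apply: (@le_trans _ _ (1 + (yz.1 0 j) ^+ 2)).
  have := sqr_ge0 (`|yz.1 0 j| - 1); rewrite -(real_normK (num_real (yz.1 0 j))).
  have := normr_ge0 (yz.1 0 j); nra.
by rewrite lerD2l (le_trans (nrm2_coord _ j))// lerDr.
Qed.

(** * The theta function *)

Section Assembly.
Context (R : realType) (p n : nat) (V : vectType rat) (B : {symmetric V})
  (u u' : V).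
Hypotheses (sgB : has_signature B p 1) (isou : B u u = 0) (isou' : B u' u' = 0)
  (uu' : B u u' = - 2^-1).
Local Notation m := (\dim {:V}).
Local Notation fR := (@formR R V B).
Local Notation tR := (@to_real R V).
Local Notation uR := (tR u).
Local Notation uR' := (tR u').
Local Notation W := (@Wreal R V B u u').
Local Notation y1 := (@y1coord R V B u').
Local Notation ym := (@ymcoord R V B u).
Local Notation wp := (@wpart R V B u u').

(** The pair (w, y_m) is carried by a full point [Z] whose own y_1-coordinates are discarded, so the
    parameter space of [ypoly] needs no separate type. *)
Definition assemble (y : 'rV[R]_n) (Z : realpts_pow R V n) : realpts_pow R V n :=
  \matrix_j (y 0 j *: uR + wp (row j Z) + ym (row j Z) *: uR').

(** The exponent of [phi0] without its y_1-part, divided by - pi. It measures the growth of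
    coefficients in [tame]. *)
Definition energy (Z : realpts_pow R V n) : R :=
  \sum_j (fR (wp (row j Z)) (wp (row j Z)) + 2^-1 * ym (row j Z) ^+ 2).

Lemma row_assemble y Z j :
  row j (assemble y Z) = y 0 j *: uR + wp (row j Z) + ym (row j Z) *: uR'.
Proof. by rewrite rowK. Qed.

Lemma y1_assemble y Z j : y1 (row j (assemble y Z)) = y 0 j.
Proof. by rewrite row_assemble (y1coord_comb isou' uu')//; exact: Wreal_wpart. Qed.

Lemma ym_assemble y Z j : ym (row j (assemble y Z)) = ym (row j Z).
Proof. by rewrite row_assemble (ymcoord_comb isou uu')//; exact: Wreal_wpart. Qed.

Lemma wp_assemble y Z j : wp (row j (assemble y Z)) = wp (row j Z).
Proof. by rewrite row_assemble (wpart_comb isou isou' uu')//; exact: Wreal_wpart. Qed.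

Lemma assembleK y y' Z : assemble y (assemble y' Z) = assemble y Z.
Proof.
by apply/row_matrixP => j; rewrite row_assemble wp_assemble ym_assemble row_assemble.
Qed.

Lemma assemble_id Z : assemble (\row_j y1 (row j Z)) Z = Z.
Proof.
by apply/row_matrixP => j; rewrite row_assemble mxE -realpts_decomp.
Qed.

Lemma energy_assemble y Z : energy (assemble y Z) = energy Z.
Proof. by apply: eq_bigr => j _; rewrite wp_assemble ym_assemble. Qed.

Lemma energy_ge0 Z : 0 <= energy Z.
Proof.
apply: sumr_ge0 => j _; apply: addr_ge0.
  exact: (Wform_ge0 sgB isou isou' uu' (Wreal_wpart isou isou' uu' _)).
by rewrite mulr_ge0 ?sqr_ge0.
Qed.

Lemma energy_row Z j :
  fR (wp (row j Z)) (wp (row j Z)) + 2^-1 * ym (row j Z) ^+ 2 <= energy Z.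
Proof.
rewrite /energy (bigD1 j)//= lerDl; apply: sumr_ge0 => i _; apply: addr_ge0.
  exact: (Wform_ge0 sgB isou isou' uu' (Wreal_wpart isou isou' uu' _)).
by rewrite mulr_ge0 ?sqr_ge0.
Qed.

(* [phi0] restricted to one [y_1]-coordinate is [exp (- ga y^2)]. *)
Definition ga : R := pi * 2^-1.

Lemma ga_gt0 : 0 < ga.
Proof. by rewrite mulr_gt0 ?pi_gt0. Qed.

Lemma phi0_assemble y Z : phi0 B u u' (assemble y Z) =
  expR (- (pi * energy Z)) * \prod_j gaussd ga 0 (y 0 j).
Proof.
rewrite /phi0 /gaussian; under [in RHS]eq_bigr => j _ do rewrite gaussd0.
rewrite -expR_sum -expRD; congr expR.
rewrite /energy sumrN -mulr_sumr -opprD mulNr; congr (- _).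
rewrite /ga -mulrA -mulrDr; congr (_ * _).
rewrite [2^-1 * _]mulr_sumr -big_split/=; apply: eq_bigr => j _.
by rewrite y1_assemble wp_assemble ym_assemble; ring.
Qed.

(** Definiteness on W ([Wreal_posdef]) bounds the entries of w by the energy, and the term y_m^2 / 2
    of the energy bounds the rest. *)
Lemma tame_entry j i : tame energy (fun Z => (wp (row j Z) + ym (row j Z) *: uR') 0 i).
Proof.
have [c c0 Hc] := @Wreal_posdef R V B p u u' sgB isou isou' uu'.
pose v : R := `|uR' 0 i|.
have v0 : 0 <= v by exact: normr_ge0.
apply: (@tame_le R _ energy energy_ge0 _ ((1 + c + 2 * v + v) : R)) => [|Z]; first lra.
have entryE (x y : realpts R V) (e : R) : (x + e *: y) 0 i = x 0 i + e * y 0 i.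
  by rewrite !mxE.
rewrite entryE.
have E0 := energy_ge0 Z.
have Eq := energy_row Z j.
set w := wp (row j Z) in Eq *; set z := ym (row j Z) in Eq *.
have Ww : W w by exact: Wreal_wpart.
have q0 := Wform_ge0 sgB isou isou' uu' Ww.
have z2 := sqr_ge0 z.
have sq (x : R) : `|x| <= 1 + x ^+ 2.
  have := sqr_ge0 (`|x| - 1); rewrite -(real_normK (num_real x)).
  have := normr_ge0 x; nra.
have h1 : `|w 0 i| <= 1 + c * energy Z.
  apply: (le_trans (sq _)); rewrite lerD2l.
  apply: (le_trans (nrm2_coord w i)); apply: (le_trans (Hc w Ww)).
  by rewrite ler_wpM2l ?(ltW c0)//; lra.
have h2 : `|z * uR' 0 i| <= (1 + 2 * energy Z) * v.
  rewrite normrM ler_wpM2r//; apply: (le_trans (sq _)); lra.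
apply: (le_trans (ler_normD _ _)); apply: (le_trans (lerD h1 h2)).
nra.
Qed.

Definition cypoly (F : 'rV[R]_n -> realpts_pow R V n -> R[i]) :=
  ypoly energy (fun y Z => complex.Re (F y Z)) /\
  ypoly energy (fun y Z => complex.Im (F y Z)).

Lemma cypoly_ext F G : (forall y Z, F y Z = G y Z) -> cypoly F -> cypoly G.
Proof.
move=> FG [h1 h2]; split; [apply: ypoly_ext h1|apply: ypoly_ext h2] => y Z;
  by rewrite FG.
Qed.

Lemma cypoly_cst c : cypoly (fun _ _ => c).
Proof. by split; apply: ypoly_cst; exact: energy_ge0. Qed.

Lemma cypoly_real Q : ypoly energy Q -> cypoly (fun y Z => (Q y Z)%:C).
Proof. by move=> h; split => //=; apply: ypoly_cst; exact: energy_ge0. Qed.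

Lemma cypoly_add F G : cypoly F -> cypoly G -> cypoly (fun y Z => F y Z + G y Z).
Proof.
move=> [h1 h2] [h3 h4]; split.
  apply: ypoly_ext (ypoly_add h1 h3) => y Z.
  by case: (F y Z) => ? ?; case: (G y Z) => ? ?.
apply: ypoly_ext (ypoly_add h2 h4) => y Z.
by case: (F y Z) => ? ?; case: (G y Z) => ? ?.
Qed.

Lemma cypoly_mul F G : cypoly F -> cypoly G -> cypoly (fun y Z => F y Z * G y Z).
Proof.
move=> [h1 h2] [h3 h4].
have hN : ypoly energy (fun (_ : 'rV[R]_n) _ => -1) by apply: ypoly_cst; exact: energy_ge0.
split.
  apply: ypoly_ext (ypoly_add (ypoly_mul h1 h3) (ypoly_mul hN (ypoly_mul h2 h4))) => y Z.
  by case: (F y Z) => ? ?; case: (G y Z) => ? ?; rewrite mulN1r.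
apply: ypoly_ext (ypoly_add (ypoly_mul h1 h4) (ypoly_mul h2 h3)) => y Z.
by case: (F y Z) => ? ?; case: (G y Z) => ? ?.
Qed.

Lemma cypoly_sum (I : Type) (r : seq I) F : (forall i, cypoly (F i)) ->
  cypoly (fun y Z => \sum_(i <- r) F i y Z).
Proof.
move=> h; elim: r => [|i r IH].
  by apply: cypoly_ext (cypoly_cst 0) => y Z; rewrite big_nil.
by apply: cypoly_ext (cypoly_add (h i) IH) => y Z; rewrite big_cons.
Qed.

Lemma cypoly_prod (I : Type) (r : seq I) F : (forall i, cypoly (F i)) ->
  cypoly (fun y Z => \prod_(i <- r) F i y Z).
Proof.
move=> h; elim: r => [|i r IH].
  by apply: cypoly_ext (cypoly_cst 1) => y Z; rewrite big_nil.
by apply: cypoly_ext (cypoly_mul (h i) IH) => y Z; rewrite big_cons.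
Qed.

Lemma cypoly_exp F k : cypoly F -> cypoly (fun y Z => F y Z ^+ k).
Proof.
move=> h; elim: k => [|k IH].
  by apply: cypoly_ext (cypoly_cst 1) => y Z; rewrite expr0.
by apply: cypoly_ext (cypoly_mul h IH) => y Z; rewrite exprS.
Qed.

Lemma is_polynomial_cypoly (P : realpts_pow R V n -> R[i]) :
  is_polynomial P -> cypoly (fun y Z => P (assemble y Z)).
Proof.
move=> [q Pq].
have hv k : cypoly (fun y Z => (mxvec (assemble y Z) 0 k)%:C).
  apply: cypoly_real; case/mxvec_indexP: k => j i.
  have h1 : ypoly energy (fun y (_ : realpts_pow R V n) => y 0 j * uR 0 i).
    apply: ypoly_mul; first by apply: ypoly_coord; exact: energy_ge0.
    by apply: ypoly_cst; exact: energy_ge0.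
  apply: ypoly_ext (ypoly_add h1 (ypoly_tame n (tame_entry j i))) => y Z.
  by rewrite mxvecE !mxE; ring.
have H := @cypoly_sum _ (mpoly.msupp q) (fun mm y Z => mpoly.mcoeff mm q *
  \prod_(i < n * m) ((mxvec (assemble y Z) 0 i)%:C ^+ (mpoly.fun_of_multinom mm i))).
apply: cypoly_ext (H _) => [y Z|mm]; last first.
  apply: cypoly_mul; first exact: cypoly_cst.
  by apply: cypoly_prod => i; apply: cypoly_exp.
by rewrite Pq mpoly.mevalE.
Qed.

Lemma energy_lower : exists2 c : R, 0 < c & forall X : realpts_pow R V n,
  c * \sum_j nrm2 (row j X) <= energy X + nrm2 (\row_j y1 (row j X)).
Proof.
have [c c0 Hc] := @Wreal_posdef R V B p u u' sgB isou isou' uu'.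
pose A := 4 * nrm2 uR + 4 * c + 8 * nrm2 uR' + 1.
have nu := nrm2_ge0 uR; have nu' := nrm2_ge0 uR'.
have A0 : 0 < A by rewrite /A; lra.
exists A^-1; first by rewrite invr_gt0.
move=> X; rewrite mulrC ler_pdivrMr// /energy /nrm2 -big_split/= mulr_suml.
apply: ler_sum => j _; rewrite -/(nrm2 (row j X)) mxE.
rewrite {1}(realpts_decomp B u u' (row j X)).
set w := wp (row j X); set z := ym (row j X); set y := y1 (row j X).
have Ww : W w by exact: Wreal_wpart.
have q0 := Wform_ge0 sgB isou isou' uu' Ww.
have hw := Hc w Ww.
have h1 := nrm2D (y *: uR + w) (z *: uR').
have h2 := nrm2D (y *: uR) w.
rewrite !nrm2Z in h1 h2.
have y2 := sqr_ge0 y; have z2 := sqr_ge0 z.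
apply: (le_trans h1).
apply: (@le_trans _ _ (4 * (y ^+ 2 * nrm2 uR) + 4 * (c * fR w w) + 2 * (z ^+ 2 * nrm2 uR'))); first lra.
have e1 : 0 <= fR w w * nrm2 uR by rewrite mulr_ge0.
have e2 : 0 <= fR w w * nrm2 uR' by rewrite mulr_ge0.
have e3 : 0 <= z ^+ 2 * nrm2 uR by rewrite mulr_ge0.
have e4 : 0 <= z ^+ 2 * nrm2 uR' by rewrite mulr_ge0.
have e5 : 0 <= y ^+ 2 * nrm2 uR by rewrite mulr_ge0.
have e6 : 0 <= y ^+ 2 * nrm2 uR' by rewrite mulr_ge0.
have e7 : 0 <= c * fR w w by rewrite mulr_ge0// ltW.
have e8 : 0 <= c * z ^+ 2 by rewrite mulr_ge0// ltW.
have e9 : 0 <= c * y ^+ 2 by rewrite mulr_ge0// ltW.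
rewrite /A; lra.
Qed.

End Assembly.

(** * Decay of the theta series, fibre by fibre *)

Section Theta.
Context (R : realType) (p n : nat) (V : vectType rat) (B : {symmetric V})
  (u u' : V) (L : set V) (h : {ffun 'I_n -> V}).
Hypotheses (sgB : has_signature B p 1) (isou : B u u = 0) (isou' : B u' u' = 0)
  (uu' : B u u' = - 2^-1) (latL : is_lattice L)
  (integralL : L `<=` dual_lattice B L) (splitL : lattice_splits B u u' L)
  (hL : forall j, dual_lattice B L (h j)).
Local Notation m := (\dim {:V}).
Local Notation fR := (@formR R V B).
Local Notation tR := (@to_real R V).
Local Notation uR := (tR u).
Local Notation uR' := (tR u').
Local Notation W := (@Wreal R V B u u').
Local Notation y1 := (@y1coord R V B u').
Local Notation ym := (@ymcoord R V B u).
Local Notation wp := (@wpart R V B u u').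
Local Notation D := (lattice_coset h L).
Local Notation energy := (@energy R n V B u u').
Local Notation assemble := (@assemble R n V B u u').
Local Notation g0 := (gaussd (@ga R) 0).
Local Notation mu := (@lebesgue_measure R).

Definition moved (t : R) (b : realpts R V) (X : {ffun 'I_n -> V}) : realpts_pow R V n :=
  to_real_pow R X *m invmx (n_mx B u u' b) *m invmx (a_mx B u u' t).

(** The shape shared by the real and imaginary parts of [theta_term]. Erasing y_1 by [assemble 0]
    makes the second argument of [Q] constant along a fibre. *)
Definition real_term (Q : 'rV[R]_n -> realpts_pow R V n -> R) (t : R)
    (b : realpts R V) (X : {ffun 'I_n -> V}) : R :=
  let X' := moved t b X in let y := \row_j y1 (row j X') in
  Q y (assemble 0 X') * (expR (- (pi * energy X')) * \prod_j g0 (y 0 j)).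

Lemma real_term_bounded Q (t : R) b : ypoly energy Q -> 0 < t -> W b ->
  exists C, bounded_sums D (real_term Q t b) C.
Proof.
move=> hQ t_gt0 Wb.
have E0 := @energy_ge0 R p n V B u u' sgB isou isou' uu'.
have pi0 := pi_gt0 R.
have d0 : 0 < pi / 4 :> R by rewrite divr_gt0.
have [C C0 HC] := ypoly_joint_tame E0 hQ d0.
have [c c0 Hc] := @energy_lower R p n V B u u' sgB isou isou' uu'.
have [K K0 HK] := nrm2_mulmx (a_mx B u u' t *m n_mx B u u' b).
(* The Gaussian exponent is at least (pi / 2)(energy + |y_1|^2). One half of it pays for [Q]; the
   other dominates 2 e times the sum of [nrm2 (tR (X j))], where the 2 is the cost of subtracting
   [h]. *)
pose e := pi / 4 * (c / (2 * K)).
have e0 : 0 < e by rewrite mulr_gt0// divr_gt0// mulr_gt0.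
have [S S0 HS] := @lattice_gauss_sum R V L latL n e e0.
pose H := \sum_j nrm2 (tR (h j)).
exists (C * expR (2 * e * H) * S) => s us sD.
have key X : `|real_term Q t b X| <=
    C * expR (2 * e * H) * expR (- (e * \sum_j nrm2 (tR (X j - h j)))).
  rewrite /real_term; set X' := moved t b X; set y := \row_j y1 (row j X').
  have P0 : 0 <= expR (- (pi * energy X')) * \prod_j g0 (y 0 j).
    by rewrite mulr_ge0 ?expR_ge0// prodr_ge0// => j _; exact: expR_ge0.
  rewrite normrM (ger0_norm P0).
  have PE : expR (- (pi * energy X')) * \prod_j g0 (y 0 j) =
      expR (- (pi * energy X' + ga R * nrm2 y)).
    under eq_bigr => j _ do rewrite gaussd0.
    by rewrite -expR_sum -expRD sumrN -mulr_sumr -opprD.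
  rewrite PE.
  have := HC (y, assemble 0 X'); rewrite /= energy_assemble// => hy.
  apply: (le_trans (ler_wpM2r (expR_ge0 _) hy)).
  rewrite -[leLHS]mulrA -[leRHS]mulrA ler_wpM2l ?(ltW C0)// -!expRD ler_expR.
  have h1 := Hc X'; rewrite -/y in h1.
  have h2 : \sum_j nrm2 (tR (X j)) <= K * \sum_j nrm2 (row j X').
    rewrite mulr_sumr; apply: ler_sum => j _; apply: le_trans (HK _).
    rewrite -row_mul /X' /moved mulmxA mulmxKV ?(a_mx_inv isou isou' uu' _).1 ?gt_eqF//.
    rewrite mulmxKV ?(n_mx_inv isou isou' uu' Wb).1//.
    by rewrite /to_real_pow rowK.
  have h3 : \sum_j nrm2 (tR (X j - h j)) <= 2 * \sum_j nrm2 (tR (X j)) + 2 * H.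
    rewrite /H !mulr_sumr -big_split/=; apply: ler_sum => j _.
    rewrite to_realB; apply: (le_trans (nrm2D _ _)).
    by rewrite -[- tR (h j)]scaleN1r nrm2Z sqrrN expr1n mul1r.
  have E0' := E0 X'; have y0 := nrm2_ge0 y.
  have h4 : e * \sum_j nrm2 (tR (X j - h j)) <=
      pi / 4 * (energy X' + nrm2 y) + 2 * e * H.
    apply: (@le_trans _ _ (e * (2 * \sum_j nrm2 (tR (X j)) + 2 * H))).
      by rewrite ler_wpM2l// ltW.
    rewrite mulrDr lerD//; last by rewrite mulrA [e * 2]mulrC.
    apply: (@le_trans _ _ (e * (2 * (K * \sum_j nrm2 (row j X'))))).
      by rewrite ler_wpM2l ?(ltW e0)// ler_wpM2l.
    rewrite /e -mulrA ler_wpM2l ?(ltW d0)//.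
    apply: le_trans h1; rewrite le_eqVlt; apply/orP; left; apply/eqP.
    by field; rewrite gt_eqF.
  have hga : ga R = pi / 2 by [].
  have p1 : 0 <= pi * energy X' by rewrite mulr_ge0// ltW.
  have p2 : 0 <= pi * nrm2 y by rewrite mulr_ge0// ltW.
  rewrite hga; lra.
apply: (@le_trans _ _ (\sum_(X <- s) C * expR (2 * e * H) *
    expR (- (e * \sum_j nrm2 (tR (X j - h j)))))).
  by apply: ler_sum => X _; exact: key.
rewrite -mulr_sumr ler_wpM2l ?mulr_ge0 ?expR_ge0 ?(ltW C0)//.
pose sh (X : {ffun 'I_n -> V}) : {ffun 'I_n -> V} := [ffun j => X j - h j].
have sh_inj : injective sh.
  by move=> X Y /ffunP E; apply/ffunP => j; have := E j; rewrite !ffunE => /addIr.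
have := HS [seq sh X | X <- s]; rewrite map_inj_uniq// big_map => /(_ us).
under eq_bigr => X _ do under eq_bigr => j _ do rewrite ffunE.
by apply => Y /mapP[X Xs ->] j; rewrite ffunE; exact: sD.
Qed.

Context (al : rat).
Hypotheses (al_gt0 : 0 < al) (Lal : L (al *: u))
  (al_gen : forall c, L (c *: u) -> exists k : int, c = k%:~R * al).
Local Notation alpha := (ratr al : R).

(* Since [L] is the direct sum of [Z al u] and the orthogonal of [u'] in [L],
   [fiber_point] is a bijection from [Z^n x fiber_base] onto [h + L^n]. *)
Definition fiber_base : set {ffun 'I_n -> V} :=
  [set x | forall j, L (x j) /\ B (x j) u' = 0].

Definition fiber_point (k : {ffun 'I_n -> int}) (x : {ffun 'I_n -> V}) :
    {ffun 'I_n -> V} := [ffun j => h j + (((k j)%:~R * al) *: u + x j)].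

Lemma fiber_point_in k x : fiber_base x -> D (fiber_point k x).
Proof.
move=> Jx j; rewrite ffunE addrC addKr; apply: (latticeD latL); last by have [] := Jx j.
by rewrite -scalerA; exact: latticeMz.
Qed.

Lemma fiber_point_surj X : D X -> exists k x, fiber_base x /\ X = fiber_point k x.
Proof.
move=> DX.
have H j : exists kx : int * V, [/\ L kx.2, B kx.2 u' = 0 &
    X j - h j = (kx.1%:~R * al) *: u + kx.2].
  have [k [x' [a1 a2 a3]]] := lattice_decomp isou' latL splitL al_gen (DX j).
  by exists (k, x').
have /choice[f Hf] := H.
exists [ffun j => (f j).1], [ffun j => (f j).2]; split.
  by move=> j; rewrite ffunE; have [] := Hf j.
by apply/ffunP => j; rewrite !ffunE; have [_ _ <-] := Hf j; rewrite addrC subrK.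
Qed.

Lemma fiber_point_inj k k' x x' : fiber_base x -> fiber_base x' ->
  fiber_point k x = fiber_point k' x' -> k = k' /\ x = x'.
Proof.
move=> Jx Jx' /ffunP E.
have H j : k j = k' j /\ x j = x' j.
  have := E j; rewrite !ffunE => /addrI.
  by apply: (lattice_decomp_uniq uu') => //; [have [] := Jx j|have [] := Jx' j].
by split; apply/ffunP => j; have [] := H j.
Qed.

Local Notation cw x j := (wp (tR (h j + x j))).
Local Notation cm x j := (ym (tR (h j + x j))).

Definition fiber_Z (t : R) (b : realpts R V) (x : {ffun 'I_n -> V}) : realpts_pow R V n :=
  \matrix_j ((0 : R) *: uR + (cw x j - cm x j *: b) + (t * cm x j) *: uR').

(** The translation of the grid caused by [h] and n(b), before scaling by 1 / t. It is unbounded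
    over the fibres, so the sum estimates have to be uniform in it. *)
Definition fiber_s (b : realpts R V) (x : {ffun 'I_n -> V}) (j : 'I_n) : R :=
  y1 (tR (h j + x j)) - 2 * fR (cw x j) b + cm x j * fR b b.

Lemma row_moved_fiber (t : R) b k x j : t != 0 -> W b ->
  row j (moved t b (fiber_point k x)) =
  ((alpha * (k j)%:~R + fiber_s b x j) / t) *: uR + (cw x j - cm x j *: b)
   + (t * cm x j) *: uR'.
Proof.
move=> t0 Wb; rewrite /moved (row_moved isou isou' uu')//.
set z := tR (h j + x j).
have E : row j (to_real_pow R (fiber_point k x)) =
   ((k j)%:~R * alpha + y1 z) *: uR + wp z + ym z *: uR'.
  rewrite /to_real_pow rowK ffunE addrCA to_realD to_realZ -/z.
  rewrite rmorphM/= ratr_int {1}(realpts_decomp B u u' z).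
  move: (y1 z) (ym z) (wp z) => a e w.
  by apply/rowP => i; rewrite !mxE; ring.
have Wz : W (wp z) by exact: Wreal_wpart.
rewrite E (y1coord_comb isou' uu')// (ymcoord_comb isou uu')// (wpart_comb isou isou' uu')//.
congr (_ *: _ + _ + _); rewrite /fiber_s -/z; ring.
Qed.

Lemma Wreal_fiber b x j : W b -> W (cw x j - cm x j *: b).
Proof.
by move=> Wb; apply: WrealD; [exact: Wreal_wpart|apply: WrealN; exact: WrealZ].
Qed.

Lemma moved_fiber (t : R) b k x : t != 0 -> W b ->
  assemble 0 (moved t b (fiber_point k x)) = fiber_Z t b x.
Proof.
move=> t0 Wb; have Ww := Wreal_fiber x _ Wb.
apply/row_matrixP => j; rewrite row_assemble rowK row_moved_fiber//.
rewrite (ymcoord_comb isou uu')// (wpart_comb isou isou' uu')//.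
by rewrite mxE.
Qed.

Lemma fiber_box_sum Q (t : R) b x M : t != 0 -> W b ->
  \sum_(i : {ffun 'I_n -> 'I_M.*2.+1})
     real_term Q t b (fiber_point [ffun j => (i j)%:Z - M%:Z] x) =
  grid_sum (ga R) alpha (Q ^~ (fiber_Z t b x)) t (fiber_s b x) M
    * expR (- (pi * energy (fiber_Z t b x))).
Proof.
move=> t0 Wb; have Ww := Wreal_fiber x _ Wb.
rewrite /grid_sum mulr_suml; apply: eq_bigr => i _; rewrite /real_term.
set k := [ffun j => _].
have E : (\row_j y1 (row j (moved t b (fiber_point k x)))) =
    grid_point alpha t (fiber_s b x) i.
  apply/rowP => j; rewrite !mxE row_moved_fiber// (y1coord_comb isou' uu')//.
  by rewrite ffunE rmorphB/= !pmulrn.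
rewrite E moved_fiber// -(energy_assemble isou isou' uu' 0 (moved _ _ _)) moved_fiber//.
by ring.
Qed.

Lemma fiber_Z_ym t b x j : W b -> ym (row j (fiber_Z t b x)) = t * cm x j.
Proof. by move=> Wb; rewrite rowK (ymcoord_comb isou uu')//; exact: Wreal_fiber. Qed.

Lemma fiber_Z_wp t b x j : W b -> wp (row j (fiber_Z t b x)) = cw x j - cm x j *: b.
Proof. by move=> Wb; rewrite rowK (wpart_comb isou isou' uu')//; exact: Wreal_fiber. Qed.

(** Since x_j is orthogonal to u', it is determined by [h] and its (w, y_m)-coordinates. The bound
    [Kb] undoes the shear of w by b, and t > t0 undoes the scaling of y_m; the Gaussian in the
    energy is then summable over the fibres. *)
Lemma fiber_energy (t0 Kb : R) : 0 < t0 -> 0 < Kb -> exists2 A : R, 0 < A &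
  exists H : R, forall t b x, t0 < t -> W b -> fR b b <= Kb -> fiber_base x ->
  \sum_j nrm2 (tR (x j)) <= A * energy (fiber_Z t b x) + H.
Proof.
move=> t00 Kb0.
have [c c0 Hc] := @Wreal_posdef R V B p u u' sgB isou isou' uu'.
have nu' := nrm2_ge0 uR'.
pose K := 8 * c * Kb + 4 * nrm2 uR'.
have K0 : 0 < K by rewrite /K; apply: ltr_pwDl; [rewrite !mulr_gt0|rewrite mulr_ge0].
pose A := 8 * c + 2 * (K / t0 ^+ 2).
have A0 : 0 < A.
  apply: addr_gt0; first by rewrite mulr_gt0.
  by rewrite mulr_gt0// divr_gt0// exprn_gt0.
exists A => //.
exists (\sum_j 2 * nrm2 (y1 (tR (h j)) *: uR - tR (h j))) => t b x tt0 Wb bK Jx.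
rewrite /energy mulr_sumr -big_split/=; apply: ler_sum => j _.
rewrite fiber_Z_ym// fiber_Z_wp//.
set z := tR (h j + x j); set w := wp z; set v := ym z.
have Ww : W w by exact: Wreal_wpart.
have Wwb : W (w - v *: b) by exact: Wreal_fiber.
have xE : tR (x j) = (w + v *: uR') + (y1 (tR (h j)) *: uR - tR (h j)).
  have zE : z = tR (h j) + tR (x j) by rewrite /z to_realD.
  have y1x : y1 (tR (x j)) = 0.
    by rewrite /y1coord formR_to_real; have [_ ->] := Jx j; rewrite rmorph0 mulr0.
  have y1z : y1 z = y1 (tR (h j)).
    by rewrite zE -[tR (h j)]scale1r y1coordP y1x mul1r addr0 scale1r.
  have := realpts_decomp B u u' z; rewrite y1z -/w -/v {1}zE => E.
  apply: (addrI (tR (h j))); rewrite E.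
  by apply/rowP => i; rewrite !mxE; ring.
rewrite xE; apply: (le_trans (nrm2D _ _)); rewrite lerD2r.
have h1 := nrm2D w (v *: uR'); rewrite nrm2Z in h1.
have h2 := Hc w Ww.
have wE : w = (w - v *: b) + v *: b by rewrite subrK.
have h3 := Wform_add sgB isou isou' uu' Wwb (WrealZ v Wb).
rewrite -wE formRZl formRZr in h3.
set q := fR (w - v *: b) (w - v *: b) in h3 *.
have q0 : 0 <= q by exact: (Wform_ge0 sgB isou isou' uu').
have v0 := sqr_ge0 v.
have h4 : fR w w <= 2 * q + 2 * (v ^+ 2 * Kb).
  apply: (le_trans h3); rewrite lerD2l ler_wpM2l// mulrA -expr2.
  by rewrite ler_wpM2l.
have h5 : c * fR w w <= c * (2 * q + 2 * (v ^+ 2 * Kb)) by rewrite ler_wpM2l// ltW.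
apply: (@le_trans _ _ (8 * c * q + v ^+ 2 * K)); first by rewrite /K; lra.
have h6 : v ^+ 2 * K <= 2 * (K / t0 ^+ 2) * (2^-1 * (t * v) ^+ 2).
  have -> : 2 * (K / t0 ^+ 2) * (2^-1 * (t * v) ^+ 2) = v ^+ 2 * K * (t ^+ 2 / t0 ^+ 2).
    by field; rewrite gt_eqF.
  apply: ler_peMr; first by rewrite mulr_ge0 ?(ltW K0).
  rewrite ler_pdivlMr ?exprn_gt0// mul1r.
  by rewrite lerXn2r ?nnegrE ?ltW// (lt_trans t00).
have h7 : 0 <= 8 * c * (2^-1 * (t * v) ^+ 2).
  apply: mulr_ge0; first by rewrite mulr_ge0// ltW.
  by rewrite mulr_ge0// sqr_ge0.
have h8 : 0 <= 2 * (K / t0 ^+ 2) * q.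
  apply: mulr_ge0 => //; rewrite mulr_ge0// divr_ge0 ?sqr_ge0//; exact: ltW.
rewrite /A; move: h6 h7 h8.
move: (K / t0 ^+ 2) (2^-1 * (t * v) ^+ 2) (v ^+ 2 * K) => r Y T h6 h7 h8; lra.
Qed.

(** The gap [eta] of [dual_ymcoord_discrete] gives energy at least (t eta)^2 / 2. The weaker bound,
    linear in t, follows from t > t0 and matches the rate sought. *)
Lemma fiber_energy_nonzero (t0 : R) : 0 < t0 -> exists2 c : R, 0 < c &
  forall t b x, t0 < t -> W b -> fiber_base x -> (exists j, cm x j != 0) ->
  c * t <= energy (fiber_Z t b x).
Proof.
move=> t00; pose eta : R := 2 * ratr al^-1.
have eta0 : 0 < eta by rewrite mulr_gt0// ltr0q invr_gt0.
exists (2^-1 * (t0 * eta ^+ 2)); first by apply: mulr_gt0 => //; apply: mulr_gt0 => //; exact: exprn_gt0.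
move=> t b x tt0 Wb Jx [j mj].
have dx : dual_lattice B L (h j + x j).
  move=> y Ly; rewrite linearDl/= rpredD//; first exact: hL.
  by have [Lx _] := Jx j; exact: integralL.
have hm := dual_ymcoord_discrete al_gt0 Lal dx mj.
apply: le_trans (energy_row sgB isou isou' uu' _ j).
rewrite fiber_Z_ym// fiber_Z_wp//.
have q0 := Wform_ge0 sgB isou isou' uu' (Wreal_fiber x j Wb).
apply: (@le_trans _ _ (2^-1 * (t * cm x j) ^+ 2)); last by rewrite lerDr.
rewrite -[leLHS]mulrA ler_wpM2l// [leRHS]exprMn -(real_normK (num_real (cm x j))).
have t_gt0 := lt_trans t00 tt0.
have h1 : eta ^+ 2 <= `|cm x j| ^+ 2 by rewrite lerXn2r ?nnegrE// ltW.
have h2 : t0 * t <= t ^+ 2 by rewrite expr2 ler_wpM2r// ltW.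
apply: (@le_trans _ _ (t ^+ 2 * eta ^+ 2)); last by rewrite ler_wpM2l// sqr_ge0.
by rewrite [leLHS]mulrAC ler_wpM2r// sqr_ge0.
Qed.

Lemma real_theta_decay Q (t0 Kb : R) : 0 < t0 -> 0 < Kb -> ypoly energy Q ->
  (forall Z, (forall j, ym (row j Z) = 0) ->
     Rn_integral (fun y => expR (- (pi * energy Z)) *
        (Q y Z * \prod_j g0 (y 0 j))) = 0) ->
  exists C1 C2 : R, [/\ 0 < C1, 0 < C2 & forall t b, t0 < t -> W b -> fR b b <= Kb ->
    `|rsum D (real_term Q t b)| <= C1 * expR (- (C2 * t))].
Proof.
move=> t00 Kb0 hQ Q0.
have pi0 := pi_gt0 R.
have alpha0 : 0 < alpha by rewrite ltr0q.
have [Qbar [mean small large]] := ypoly_mean (ga_gt0 R) alpha0 t00 hQ.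
(* The only use of the hypothesis on the integrals: the exponential and the power of the Gaussian
   integral are nonzero, so [Qbar Z] must vanish. *)
have Qbar0 Z : (forall j, ym (row j Z) = 0) -> Qbar Z = 0.
  move=> /Q0; rewrite mean => /eqP.
  have I0 := Rintegral_gauss_gt0 (ga_gt0 R).
  by rewrite !mulf_eq0 expR_eq0 expf_eq0 (gt_eqF I0) andbF orbF => /eqP.
have d0 : 0 < pi / 2 :> R by rewrite divr_gt0.
have [c c0 Hc] := fiber_energy_nonzero t00.
have [A A0 [H HA]] := fiber_energy t00 Kb0.
have [C1 [C2 [C10 C20 Hs]]] := small _ d0.
(* A quarter of the exponent, (pi / 4) E, is at least 2 d' t when y_m <> 0; one d' t cancels the
   growth of the grid sum and the other is the resulting decay. *)
pose d' := pi / 8 * c.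
have d'0 : 0 < d' by rewrite mulr_gt0// divr_gt0.
have [C3 C30 Hl] := large _ _ d0 d'0.
(* By [fiber_energy], exp (- (pi / 4) E) is at most a constant times a Gaussian of this width in x,
   summable over the fibres. *)
have eA : 0 < pi / 4 / A by rewrite !divr_gt0.
have [S S0 HS] := @lattice_gauss_sum R V L latL n _ eA.
pose c2 := Num.min C2 d'.
have c20 : 0 < c2 by rewrite lt_min C20.
pose Cm := C1 + C3.
have Cm0 : 0 < Cm by rewrite addr_gt0.
exists (Cm * expR (pi / 4 / A * H) * S), c2; split => //.
  by rewrite !mulr_gt0 ?expR_gt0.
move=> t b tt0 Wb bK.
have t_gt0 := lt_trans t00 tt0.
have tn0 : t != 0 by rewrite gt_eqF.
have [C HC] := real_term_bounded hQ t_gt0 Wb.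
pose Bd (x : {ffun 'I_n -> V}) := Cm * expR (pi / 4 / A * H) * expR (- (c2 * t)) *
   expR (- (pi / 4 / A * \sum_j nrm2 (tR (x j)))).
apply: (@rsum_fibered_bound R _ D _ fiber_base n fiber_point _ C _ Bd HC).
- by move=> k x; exact: fiber_point_in.
- exact: fiber_point_surj.
- by move=> k k' x x'; exact: fiber_point_inj.
- move=> x Jx e e0.
  set Z := fiber_Z t b x; set E := energy Z.
  have E0 : 0 <= E by exact: (energy_ge0 sgB isou isou' uu').
  have BdE : Cm * expR (- (c2 * t)) * expR (- (pi / 4 * E)) <= Bd x.
    rewrite /Bd -!mulrA ler_wpM2l ?(ltW Cm0)// -!expRD ler_expR.
    have hE := HA t b x tt0 Wb bK Jx; rewrite -/Z -/E in hE.
    have := ler_wpM2l (ltW eA) hE.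
    have -> : pi / 4 / A * (A * E + H) = pi / 4 * E + pi / 4 / A * H.
      by field; rewrite gt_eqF.
    lra.
  have expE1 : expR (- (pi * E)) <= 1.
    by rewrite expR_le1 oppr_le0 mulr_ge0// ltW.
  have ct : expR (- (C2 * t)) <= expR (- (c2 * t)).
    by rewrite ler_expR lerN2 ler_wpM2r ?(ltW t_gt0)// ge_min lexx.
  have ct' : expR (- (d' * t)) <= expR (- (c2 * t)).
    by rewrite ler_expR lerN2 ler_wpM2r ?(ltW t_gt0)// ge_min lexx orbT.
  have [[j mj]|nm] := pselect (exists j, cm x j != 0).
    exists 0%N => M _; rewrite fiber_box_sum// -/Z -/E normrM (ger0_norm (expR_ge0 _)).
    apply: (@le_trans _ _ (Bd x)); last by rewrite lerDl ltW.
    apply: le_trans BdE.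
    apply: (le_trans (ler_wpM2r (expR_ge0 _) (Hl Z t (fiber_s b x) M tt0))).
    rewrite -/E.
    have hc := Hc t b x tt0 Wb Jx (ex_intro _ j mj); rewrite -/Z -/E in hc.
    apply: (@le_trans _ _ (C3 * (expR (- (d' * t)) * expR (- (pi / 4 * E))))).
      rewrite -!mulrA ler_wpM2l ?(ltW C30)// -!expRD ler_expR /d'.
      have := ler_wpM2l (ltW (divr_gt0 pi0 (ltr0n _ 4))) hc; lra.
    rewrite -[leRHS]mulrA; apply: ler_pM; rewrite ?(ltW C30) ?mulr_ge0 ?expR_ge0//.
      by rewrite /Cm lerDr ltW.
    by rewrite ler_wpM2r ?expR_ge0.
  have ym0 j : ym (row j Z) = 0.
    rewrite fiber_Z_ym//; have [->|mj] := eqVneq (cm x j) 0; first by rewrite mulr0.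
    by case: nm; exists j.
  have [M0 HM0] := Hs Z t e (fiber_s b x) tt0 e0.
  exists M0 => M /HM0; rewrite Qbar0// mul0r subr0 -/E => hM.
  rewrite fiber_box_sum// -/Z -/E normrM (ger0_norm (expR_ge0 _)).
  apply: (le_trans (ler_wpM2r (expR_ge0 _) hM)).
  rewrite mulrDl addrC; apply: lerD; last by rewrite ler_piMr// ltW.
  apply: le_trans BdE.
  apply: (@le_trans _ _ (C1 * (expR (- (C2 * t)) * expR (- (pi / 4 * E))))).
    rewrite -!mulrA ler_wpM2l ?(ltW C10)// -!expRD ler_expR.
    have p1 : 0 <= pi * E by rewrite mulr_ge0// ltW.
    lra.
  rewrite -[leRHS]mulrA; apply: ler_pM; rewrite ?(ltW C10) ?mulr_ge0 ?expR_ge0//.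
    by rewrite /Cm lerDl ltW.
  by rewrite ler_wpM2r ?expR_ge0.
- move=> F uF FJ; rewrite /Bd -mulr_sumr.
  have := HS F uF (fun X XF j => (FJ X XF j).1) => hS.
  rewrite [leRHS]mulrAC ler_wpM2l// !mulr_ge0 ?expR_ge0// ltW//.
Qed.

End Theta.

Lemma normc_le (R : realType) (z : R[i]) :
  complex.Re `|z| <= `|complex.Re z| + `|complex.Im z| /\
  (forall K : R, `|complex.Re z| + `|complex.Im z| <= K -> `|z| <= K%:C).
Proof.
have h : complex.Re `|z| <= `|complex.Re z| + `|complex.Im z|.
  case: z => a b; rewrite normc_def/=.
  apply: (@le_trans _ _ (Num.sqrt ((`|a| + `|b|) ^+ 2))).
    rewrite ler_sqrt ?sqr_ge0// sqrrD !real_normK ?num_real//.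
    by rewrite addrAC lerDl mulrn_wge0// mulr_ge0.
  by rewrite sqrtr_sqr ger0_norm// addr_ge0.
split => // K hK.
have -> : `|z| = (complex.Re `|z|)%:C by case: z {h hK} => a b; rewrite normc_def.
by rewrite lecR (le_trans h).
Qed.

Theorem lemma5p4 (R : realType) (p n : nat) (V : vectType rat)
    (B : {symmetric V}) (u0 u0' : V) (L : set V) (h : {ffun 'I_n -> V})
    (Omega : set (realpts R V)) (t0 : R) (phi : realpts_pow R V n -> R[i])
    (dimV : \dim {:V} = p.+1)
    (ndB : nondegenerate B)
    (sgB : has_signature B p 1)
    (isou0 : B u0 u0 = 0)
    (isou0' : B u0' u0' = 0)
    (u0u0' : B u0 u0' = - 2^-1)
    (latL : is_lattice L)
    (integralL : L `<=` dual_lattice B L)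
    (splitL : lattice_splits B u0 u0' L)
    (n_ge1 : (1 <= n)%N) (n_le_p : (n <= p)%N)
    (hL : forall j, dual_lattice B L (h j))
    (OmegaP : rel_compact_open_in_W B u0 u0' Omega)
    (t0_gt0 : 0 < t0)
    (phiP : fock_space B u0 u0' phi)
    (FphiP : vanishing_ideal B u0 u0' (fourier0 B u0 u0' phi)) :
  (forall t b, 0 < t -> Wreal B u0 u0' b ->
     csummable (lattice_coset h L) (theta_term B u0 u0' phi t b)) /\
  exp_decreasing_on B u0 u0' (siegel_set B u0 u0' Omega t0)
    (theta B u0 u0' phi h L).
Proof.
have [P polyP phiE] := phiP.
have [hRe hIm] := is_polynomial_cypoly sgB isou0 isou0' u0u0' polyP.
pose F y Z := P (assemble B u0 u0' y Z).
pose Qr y Z := complex.Re (F y Z); pose Qi y Z := complex.Im (F y Z).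
have reM (z : R[i]) (c : R) : complex.Re (z * c%:C) = complex.Re z * c.
  by case: z => a b /=; rewrite mulr0 subr0.
have imM (z : R[i]) (c : R) : complex.Im (z * c%:C) = complex.Im z * c.
  by case: z => a b /=; rewrite mulr0 add0r.
have phiA y Z : phi (assemble B u0 u0' y Z) = F y Z *
    (expR (- (pi * energy B u0 u0' Z)) * \prod_j gaussd (ga R) 0 (y 0 j))%:C.
  by rewrite phiE (phi0_assemble isou0 isou0' u0u0').
have termE t b X : theta_term B u0 u0' phi t b X =
   real_term B u0 u0' Qr t b X +i* real_term B u0 u0' Qi t b X.
  rewrite /theta_term -/(moved B u0 u0' t b X) /real_term.
  set X' := moved B u0 u0' t b X; set y := \row_j y1coord B u0' (row j X').
  have E : X' = assemble B u0 u0' y (assemble B u0 u0' 0 X').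
    by rewrite (assembleK isou0 isou0' u0u0') assemble_id.
  rewrite {1}E phiA (energy_assemble isou0 isou0' u0u0').
  by apply/eqP; rewrite eq_complex reM imM !eqxx.
(* At xi = 0 the character in the Fourier integral is 1, so the value of F_0 phi at (0, w, 0) is the
   plain integral of phi over y_1. *)
have int0 Z : (forall j, ymcoord B u0 (row j Z) = 0) ->
    Cn_integral (fun y => phi (assemble B u0 u0' y Z)) = 0.
  move=> ym0; have [_ /(_ (assemble B u0 u0' 0 Z))] := FphiP.
  set Y := assemble B u0 u0' 0 Z => FY.
  have y1Y j : y1coord B u0' (row j Y) = 0 by rewrite (y1_assemble isou0 isou0' u0u0') mxE.
  have ymY j : ymcoord B u0 (row j Y) = 0 by rewrite (ym_assemble isou0 isou0' u0u0').
  rewrite -FY => [|j]; last by rewrite y1Y ymY.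
  rewrite /fourier0; congr Cn_integral; apply/funext => y.
  rewrite big1 => [|j _]; last by rewrite y1Y mul0r.
  rewrite mulr0 oppr0 /cis cos0 sin0 -[1 +i* 0]/(1 : R[i]) mulr1.
  congr phi; rewrite -(assembleK isou0 isou0' u0u0' y 0 Z) -/Y.
  by apply/row_matrixP => j; rewrite !rowK.
have r0 Z : (forall j, ymcoord B u0 (row j Z) = 0) ->
    Rn_integral (fun y => expR (- (pi * energy B u0 u0' Z)) *
      (Qr y Z * \prod_j gaussd (ga R) 0 (y 0 j))) = 0.
  move=> /int0 /(f_equal (@complex.Re R)) /= <-; congr Rn_integral; apply/funext => y.
  by rewrite phiA reM -/(Qr y Z); ring.
have i0 Z : (forall j, ymcoord B u0 (row j Z) = 0) ->
    Rn_integral (fun y => expR (- (pi * energy B u0 u0' Z)) *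
      (Qi y Z * \prod_j gaussd (ga R) 0 (y 0 j))) = 0.
  move=> /int0 /(f_equal (@complex.Im R)) /= <-; congr Rn_integral; apply/funext => y.
  by rewrite phiA imM -/(Qi y Z); ring.
split.
  move=> t b t_gt0 Wb.
  have [Cr HCr] := real_term_bounded h sgB isou0 isou0' u0u0' latL hRe t_gt0 Wb.
  have [Ci HCi] := real_term_bounded h sgB isou0 isou0' u0u0' latL hIm t_gt0 Wb.
  rewrite /csummable /summable; apply: le_lt_trans (ltry (Cr + Ci)).
  apply: bounded_sums_esum => s us sD.
  apply: le_trans (lerD (HCr s us sD) (HCi s us sD)); rewrite -big_split/=.
  apply: ler_sum => X _; have [hn _] := normc_le (theta_term B u0 u0' phi t b X).
  rewrite ger0_norm; first by rewrite (le_trans hn)// termE.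
  by case: (theta_term _ _ _ _ _ _ _) => a' b'; rewrite /= sqrtr_ge0.
have [OW [Kb Kb0 HKb]] := rel_compact_form_bound OmegaP.
have [al [al0 Lal al_gen]] := lattice_generator u0u0' latL integralL.
have [C1 [C2 [C10 C20 HC]]] := real_theta_decay sgB isou0 isou0' u0u0' latL
  integralL splitL hL al0 Lal al_gen t0_gt0 Kb0 hRe r0.
have [C1' [C2' [C10' C20' HC']]] := real_theta_decay sgB isou0 isou0' u0u0' latL
  integralL splitL hL al0 Lal al_gen t0_gt0 Kb0 hIm i0.
exists (C1 + C1'), (Num.min C2 C2'); split.
- exact: addr_gt0.
- by rewrite lt_min C20.
(* Membership of the point in the Siegel set is turned back into t0 < t and b in [Omega], which
   yields the bound [Kb] on (b, b). *)
move=> t b t_gt0 Wb /(siegel_coords isou0 isou0' u0u0' t_gt0 Wb OW t0_gt0)[tt0 Ob].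
have bK := HKb b Ob.
have [_ hn] := normc_le (theta B u0 u0' phi h L t b).
apply: hn; rewrite /theta /csum /=.
have -> : (fun X => complex.Re (theta_term B u0 u0' phi t b X)) = real_term B u0 u0' Qr t b.
  by apply/funext => X; rewrite termE.
have -> : (fun X => complex.Im (theta_term B u0 u0' phi t b X)) = real_term B u0 u0' Qi t b.
  by apply/funext => X; rewrite termE.
rewrite mulrDl; apply: lerD.
  apply: (le_trans (HC t b tt0 Wb bK)); rewrite ler_wpM2l ?(ltW C10)// ler_expR mulNr lerN2.
  by rewrite ler_wpM2r ?(ltW t_gt0)// ge_min lexx.
apply: (le_trans (HC' t b tt0 Wb bK)); rewrite ler_wpM2l ?(ltW C10')// ler_expR mulNr lerN2.
by rewrite ler_wpM2r ?(ltW t_gt0)// ge_min lexx orbT.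
Qed.
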